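(* Let $F$ be a global field and let $E=[0\to(M_1,\mathscr{W}_1)\xrightarrow{\iota}(M,\mathscr{W})\xrightarrow{\pi}(M_2,\mathscr{W}_2)\to0]$ be an exact sequence in $\mathrm{SMod}_F$ or in $\mathrm{SMod}^{\infty}_{F,\ell}$ ($\ell$ a prime different from the characteristic of $F$). Let $\mathcal{H}$ be a theta group for $M$ and let $\mathcal{H}_1$ be the preimage of $\iota(M_1)$ in $\mathcal{H}$. Assume: (1) $\mathcal{H}_1$ is commutative; (2) $q_{\mathrm{loc\text{-}sum}}$ vanishes on $\iota(\mathscr{W}_1)$; (3) $\iota(\mathscr{W}_1)\subseteq f_{\mathcal{H}}(\mathscr{W})^{\perp}$. Let $\psi_{\mathrm{PS}}\in\mathrm{Sel}\,M_1^{\vee}$ be the associated Poonen–Stoll class and $f_2\colon M_2\to M_1^{\vee}$ the morphism induced by $f_{\mathcal{H}}$. Let $\phi\in\mathrm{Sel}\,M_2$, and choose $(\phi_{v,M})_v\in\mathscr{W}$ projecting under $\pi$ to the image of $\phi$ in $\mathscr{W}_2$. Then $$\mathrm{CTP}_E\big(\phi,\ \psi_{\mathrm{PS}}-f_2(\phi)\big)=q_{\mathrm{loc\text{-}sum}}\big((\phi_{v,M})_v\big).$$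
   Context: Notation. $G_F=\mathrm{Gal}(F^s/F)$; for each place $v$, $G_v\subseteq G_F$ is the absolute Galois group of $F_v$, $I_v\subseteq G_v$ inertia ($=G_v$ if $v$ archimedean), $H^1_{\mathrm{ur}}(G_v,N)=\ker(H^1(G_v,N)\to H^1(I_v,N))$. Cohomology is continuous cochain cohomology; $C^i,Z^i$ are continuous inhomogeneous cochains/cocycles, $d$ the usual coboundary; $\mathrm{inv}_v\colon H^2(G_v,(F_v^s)^{\times})\to\mathbb{Q}/\mathbb{Z}$ is the invariant map; $(F^s)^{\times}$ is discrete. Cup products of cochains: $(f_1\cup f_2)(\sigma_1,\dots,\sigma_{i+j})=P(f_1(\sigma_1,\dots,\sigma_i),\sigma_1\cdots\sigma_if_2(\sigma_{i+1},\dots,\sigma_{i+j}))$; $\cup_M$ uses the evaluation pairing $\langle\,,\rangle$ on $M\times M^{\vee}$. $\mathrm{SMod}_F$: objects $(M,\mathscr{W})$, $M$ a finite discrete $G_F$-module of order indivisible by $\mathrm{char}\,F$, $\mathscr{W}$ a compact open subgroup of the restricted product $\prod'_vH^1(G_v,M)$ with respect to the $H^1_{\mathrm{ur}}(G_v,M)$. $\mathrm{SMod}^{\infty}_{F,\ell}$: objects $(M,\mathscr{W})$ where $M$ is an acceptable module, i.e. a Hausdorff topological $\mathbb{Z}_\ell$-module with continuous $\mathbb{Z}_\ell$-linear $G_F$-action, containing an open compact $\mathbb{Z}_\ell[G_F]$-submodule $U$ such that $U$ and the Pontryagin dual of $M/U$ are finitely generated over $\mathbb{Z}_\ell$, and with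 $M^{I_v}=M$ for almost all $v$; and $\mathscr{W}=\mathscr{W}_S\times\prod_{v\notin S}H^1_{\mathrm{ur}}(G_v,M)$ for some finite set $S$ of places and $\mathbb{Z}_\ell$-submodule $\mathscr{W}_S\subseteq\prod_{v\in S}H^1(G_v,M)$. Morphisms in either category are equivariant ($\mathbb{Z}_\ell$-linear in the second case) homomorphisms $f$ with $f(\mathscr{W})\subseteq\mathscr{W}'$. Duals: $M^{\vee}=\mathrm{Hom}_{\mathrm{cont}}(M,(F^s)^{\times})$ (compact-open topology) with local conditions the orthogonal complement $\mathscr{W}^{\perp}\subseteq\prod'_vH^1(G_v,M^{\vee})$ of $\mathscr{W}$ under $\sum_v\mathrm{inv}_v(x_v\cup_My_v)$. $\mathrm{Sel}(M,\mathscr{W})$ is the group of classes in $H^1(G_F,M)$ whose localizations lie in $\mathscr{W}$. $E$ is exact if exact on underlying modules with $\iota^{-1}(\mathscr{W})=\mathscr{W}_1$, $\pi(\mathscr{W})=\mathscr{W}_2$. $\mathrm{CTP}_E\colon\mathrm{Sel}\,M_2\times\mathrm{Sel}\,M_1^{\vee}\to\mathbb{Q}/\mathbb{Z}$: for $\phi,\psi$ choose representing cocycles $\overline{\phi},\overline{\psi}$; $f\in C^1(G_F,M)$ with $\pi\circ f=\overline{\phi}$; $\epsilon\in C^2(G_F,(F^s)^{\times})$ with $d\epsilon=\iota^{-1}(df)\cup_{M_1}\overline{\psi}$; and $\overline{\phi}_{v,M}\in Z^1(G_v,M)$ with $\pi(\overline{\phi}_{v,M})=\overline{\phi}_v$,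 with $(\overline{\phi}_{v,M})_v$ representing a class in $\mathscr{W}$. Then $\mathrm{CTP}_E(\phi,\psi)=\sum_v\mathrm{inv}_v\big(\iota^{-1}(f_v-\overline{\phi}_{v,M})\cup_{M_1}\overline{\psi}_v-\epsilon_v\big)$. This is well defined and bilinear. Theta groups. A theta group for $M$ is a topological group $\mathcal{H}$ with continuous $G_F$-action in a $G_F$-equivariant exact sequence $0\to(F^s)^{\times}\to\mathcal{H}\xrightarrow{\pi_{\mathcal{H}}}M\to0$ with $(F^s)^{\times}$ central, $\pi_{\mathcal{H}}$ continuous and open, and such that some open subgroup of $\mathcal{H}$ has preimage $\{1\}$ in $(F^s)^{\times}$. The associated map $f_{\mathcal{H}}\colon M\to M^{\vee}$ is the homomorphism with $ghg^{-1}h^{-1}=\langle\pi_{\mathcal{H}}(g),f_{\mathcal{H}}(\pi_{\mathcal{H}}(h))\rangle$; it satisfies $f_{\mathcal{H}}^{\vee}=-f_{\mathcal{H}}$. For a closed subgroup $H\le G_F$, $q_{\mathcal{H},H}\colon H^1(H,M)\to H^2(H,(F^s)^{\times})$ sends the class of $a\in Z^1(H,M)$ to the class of $db$, where $b\colon H\to\mathcal{H}$ is continuous with $\pi_{\mathcal{H}}\circ b=a$ and $db(\sigma,\tau)=b(\sigma)\cdot\sigma b(\tau)\cdot b(\sigma\tau)^{-1}$. Define $q_{\mathrm{loc\text{-}sum}}\colon\prod'_vH^1(G_v,M)\to\mathbb{Q}/\mathbb{Z}$ by $(\phi_v)_v\mapsto\sum_v\mathrm{inv}_v(q_{\mathcal{H},G_v}(\phi_v))$.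 When $\mathcal{H}_1$ is commutative there is a unique equivariant $f_2\colon M_2\to M_1^{\vee}$ with $f_2\circ\pi=\iota^{\vee}\circ f_{\mathcal{H}}$; by (3) it is a morphism in the category. The Poonen–Stoll class: view $\mathcal{H}_1$ as an extension of $M_1$ by $(F^s)^{\times}$ with projection $\pi_{\mathcal{H}_1}$, choose a continuous homomorphism $s\colon M_1\to\mathcal{H}_1$ with $\pi_{\mathcal{H}_1}\circ s=\mathrm{id}$ (one exists), and let $\overline{\psi}_{\mathrm{PS}}\in Z^1(G_F,M_1^{\vee})$ be $\overline{\psi}_{\mathrm{PS}}(\sigma)(m)=\sigma s(\sigma^{-1}m)-s(m)$ (additive notation in $\mathcal{H}_1$); $\psi_{\mathrm{PS}}$ is its class in $H^1(G_F,M_1^{\vee})$. Under (1)–(3) it lies in $\mathrm{Sel}\,M_1^{\vee}$. *)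

(* Defs.v *)
From HB Require Import structures.
From mathcomp Require Import all_boot all_order all_algebra separable.
From mathcomp Require Import generic_quotient ring_quotient.
From mathcomp Require Import all_classical all_reals.
From mathcomp Require Import topology function_spaces tvs exp.

Set Implicit Arguments.
Unset Strict Implicit.
Unset Printing Implicit Defensive.

Import Order.TTheory GRing.Theory Num.Theory.

Local Open Scope classical_set_scope.
Local Open Scope ring_scope.

HB.structure Definition TopGroup := {G of Group G & Topological G}.
Notation topGroupType := TopGroup.type.

Section Modulo.
Variable K : archiNumDomainType.

Definition int_pred : {pred K} := fun x => x \is a Num.int.

Fact int_pred_closed : zmod_closed int_pred.
Proof. by split=> [|x y]; [exact: rpred0 | exact: rpredB]. Qed.

HB.instance Definition _ := GRing.isZmodClosed.Build K int_pred int_pred_closed.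

Definition moduloZ : zmodType := Quotient.quot int_pred.

Definition toModZ (r : K) : moduloZ := \pi_(Quotient.quot int_pred)%qT r.

End Modulo.

Notation QmodZ := (moduloZ rat).

Section PadicIntegers.
Variable l : nat.

(* For l >= 2 the type 'Z_(l ^ n.+1) is Z / l ^ n.+1. *)
Definition reduceZ n (a : 'Z_(l ^ n.+2)) : 'Z_(l ^ n.+1) := inZp a.

Record Zl := MkZl {
  digits :> forall n, 'Z_(l ^ n.+1);
  Zl_coherent : forall n, reduceZ (digits n.+1) = digits n }.

Lemma Zl_eq (x y : Zl) : (forall n, x n = y n) -> x = y.
Proof.
case: x y => [x xc] [y yc] /= xy.
have {}xy : x = y by exact: functional_extensionality_dep.
by case: _ / xy yc => yc; congr MkZl; exact: Prop_irrelevance.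
Qed.

HB.instance Definition _ := gen_eqMixin Zl.
HB.instance Definition _ := gen_choiceMixin Zl.

Let dvd_mod n : ((Zp_trunc (l ^ n.+1)).+2 %| (Zp_trunc (l ^ n.+2)).+2)%N.
Proof.
case: l => [|[|k]]; first by rewrite !exp0n.
  by rewrite !exp1n.
have gt1 m : (1 < k.+2 ^ m.+1)%N by rewrite -{1}(expn0 k.+2) ltn_exp2l.
by rewrite !Zp_cast // dvdn_exp2l.
Qed.

Let reduceZ_val n (a : 'Z_(l ^ n.+2)) :
  reduceZ a = (a %% (Zp_trunc (l ^ n.+1)).+2)%N :> nat.
Proof. by []. Qed.

Let reduceD n : {morph @reduceZ n : a b / a + b}.
Proof.
by move=> a b; apply: val_inj => /=; rewrite modn_dvdm // modnDm.
Qed.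

Let reduceM n : {morph @reduceZ n : a b / a * b}.
Proof.
by move=> a b; apply: val_inj => /=; rewrite modn_dvdm // modnMm.
Qed.

Let reduce1 n : @reduceZ n 1 = 1.
Proof. by apply: val_inj. Qed.

Let reduce0 n : @reduceZ n 0 = 0.
Proof. by apply: val_inj. Qed.

Let reduceN n : {morph @reduceZ n : a / - a}.
Proof.
by move=> a; apply/eqP; rewrite -addr_eq0 -reduceD addNr reduce0.
Qed.

Definition Zl_zero : Zl := @MkZl (fun n => 0) (@reduce0).
Definition Zl_one : Zl := @MkZl (fun n => 1) (@reduce1).

Fact Zl_oppP (x : Zl) n : reduceZ (- x n.+1) = - x n.
Proof. by rewrite -[x n]Zl_coherent; exact: reduceN. Qed.
Fact Zl_addP (x y : Zl) n : reduceZ (x n.+1 + y n.+1) = x n + y n.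
Proof. by rewrite -[x n]Zl_coherent -[y n]Zl_coherent; exact: reduceD. Qed.
Fact Zl_mulP (x y : Zl) n : reduceZ (x n.+1 * y n.+1) = x n * y n.
Proof. by rewrite -[x n]Zl_coherent -[y n]Zl_coherent; exact: reduceM. Qed.

Definition Zl_opp (x : Zl) : Zl := MkZl (Zl_oppP x).
Definition Zl_add (x y : Zl) : Zl := MkZl (Zl_addP x y).
Definition Zl_mul (x y : Zl) : Zl := MkZl (Zl_mulP x y).

Fact Zl_addA : associative Zl_add.
Proof. by move=> x y z; apply: Zl_eq => n /=; exact: addrA. Qed.
Fact Zl_addC : commutative Zl_add.
Proof. by move=> x y; apply: Zl_eq => n /=; exact: addrC. Qed.
Fact Zl_add0 : left_id Zl_zero Zl_add.
Proof. by move=> x; apply: Zl_eq => n /=; exact: add0r. Qed.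
Fact Zl_addN : left_inverse Zl_zero Zl_opp Zl_add.
Proof. by move=> x; apply: Zl_eq => n /=; exact: addNr. Qed.
HB.instance Definition _ :=
  GRing.isZmodule.Build Zl Zl_addA Zl_addC Zl_add0 Zl_addN.

Fact Zl_mulA : associative Zl_mul.
Proof. by move=> x y z; apply: Zl_eq => n /=; exact: mulrA. Qed.
Fact Zl_mulC : commutative Zl_mul.
Proof. by move=> x y; apply: Zl_eq => n /=; exact: mulrC. Qed.
Fact Zl_mul1 : left_id Zl_one Zl_mul.
Proof. by move=> x; apply: Zl_eq => n /=; exact: mul1r. Qed.
Fact Zl_mulD : left_distributive Zl_mul +%R.
Proof. by move=> x y z; apply: Zl_eq => n /=; exact: mulrDl. Qed.
Fact Zl_1neq0 : Zl_one != 0.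
Proof. by apply/eqP => /(congr1 (fun x : Zl => x 0)) /eqP; rewrite oner_eq0. Qed.
HB.instance Definition _ := GRing.Zmodule_isComNzRing.Build Zl
  Zl_mulA Zl_mulC Zl_mul1 Zl_mulD Zl_1neq0.

HB.instance Definition _ := Topological.copy Zl
  (initial_topology (digits : Zl ->
     prod_topology (fun n => discrete_topology 'Z_(l ^ n.+1)))).

End PadicIntegers.

Section FieldExtensions.

Definition finite_ext (K L : fieldType) (i : {rmorphism K -> L}) :=
  exists n (e : 'I_n -> L), forall x, exists c : 'I_n -> K,
    x = \sum_k i (c k) * e k.

Definition global_field (F : fieldType) :=
  (exists i : {rmorphism rat -> F}, finite_ext i) \/
  (exists2 p, prime p &
   exists i : {rmorphism {fraction {poly 'F_p}} -> F}, finite_ext i).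

Definition separable_closure (K L : fieldType) (i : {rmorphism K -> L}) :=
  (forall x, exists2 p : {poly K}, separable_poly p & root (map_poly i p) x) /\
  (forall p : {poly L}, separable_poly p -> (1 < size p)%N ->
     exists x, root p x).

End FieldExtensions.

Section Galois.
Variables (K L : fieldType) (i : {rmorphism K -> L}).

Definition is_gal (f : L -> L) :=
  [/\ zmod_morphism f, monoid_morphism f, bijective f & forall x, f (i x) = i x].

Definition gal_pred : pred (L -> L) := fun f => `[< is_gal f >].

Record gal := MkGal { gal_fun :> L -> L; _ : gal_pred gal_fun }.

HB.instance Definition _ := [isSub for gal_fun].
HB.instance Definition _ := [Choice of gal by <:].

Lemma galP (s : gal) : is_gal s.
Proof. by case: s => f /= /asboolP. Qed.

Lemma gal_eq (s t : gal) : s =1 t -> s = t.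
Proof. by move=> st; apply: val_inj; apply: funext. Qed.

Fact is_gal1 : is_gal id.
Proof. by split => //; exists id. Qed.

Fact is_galM (s t : gal) : is_gal (s \o t).
Proof.
have [s1 [s2 s2'] s3 s4] := galP s; have [t1 [t2 t2'] t3 t4] := galP t.
split; last by move=> x /=; rewrite t4 s4.
- by move=> x y /=; rewrite t1 s1.
- by split=> [|x y] /=; [rewrite t2 s2 | rewrite t2' s2'].
- exact: bij_comp.
Qed.

Definition gal_inv_fun (s : gal) : L -> L := fun y => xget 0 [set x | s x = y].

Lemma gal_invK (s : gal) : cancel (gal_inv_fun s) s.
Proof.
move=> y; have [_ _ [g _ gK] _] := galP s.
by rewrite /gal_inv_fun; case: xgetP => [x _ //|/(_ (g y))]; case; rewrite /= gK.
Qed.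

Lemma gal_Kinv (s : gal) : cancel s (gal_inv_fun s).
Proof.
by move=> x; have [_ _ /bij_inj sI _] := galP s; apply: sI; rewrite gal_invK.
Qed.

Fact is_galV (s : gal) : is_gal (gal_inv_fun s).
Proof.
have [s1 [s2 s2'] /bij_inj sI s4] := galP s.
split.
- by move=> x y; apply: sI; rewrite s1 !gal_invK.
- by split=> [|x y]; apply: sI; rewrite ?s2' !gal_invK ?s2.
- by exists s; [exact: gal_invK | exact: gal_Kinv].
- by move=> x; apply: sI; rewrite s4 gal_invK.
Qed.

Definition gal_of f (fP : is_gal f) : gal := @MkGal f (asboolT fP).

Definition gal_one := gal_of is_gal1.
Definition gal_mul s t := gal_of (is_galM s t).
Definition gal_inv s := gal_of (is_galV s).

Fact gal_mulA : associative gal_mul.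
Proof. by move=> s t u; exact: gal_eq. Qed.
Fact gal_mul1 : left_id gal_one gal_mul.
Proof. by move=> s; exact: gal_eq. Qed.
Fact gal_mulr1 : right_id gal_one gal_mul.
Proof. by move=> s; exact: gal_eq. Qed.
Fact gal_mulV : left_inverse gal_one gal_inv gal_mul.
Proof. by move=> s; apply: gal_eq => x /=; exact: gal_Kinv. Qed.
Fact gal_mulrV : right_inverse gal_one gal_inv gal_mul.
Proof. by move=> s; apply: gal_eq => x /=; exact: gal_invK. Qed.

HB.instance Definition _ :=
  isGroup.Build gal gal_mulA gal_mul1 gal_mulr1 gal_mulV gal_mulrV.

(* The Krull topology, for L algebraic over K. *)
HB.instance Definition _ := Topological.copy gal
  (initial_topology (gal_fun : gal -> {ptws L -> discrete_topology L})).

End Galois.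

(* The multiplicative group of K, written additively. *)
Section MultiplicativeGroup.
Variable K : fieldType.

Record Gm := MkGm { gm_val :> K; gm_neq0 : gm_val != 0 }.

HB.instance Definition _ := [isSub for gm_val].
HB.instance Definition _ := [Choice of Gm by <:].

Definition gm_one : Gm := MkGm (oner_neq0 K).
Definition gm_mul (x y : Gm) : Gm := MkGm (mulf_neq0 (gm_neq0 x) (gm_neq0 y)).
Fact gm_inv_neq0 (x : Gm) : (x : K)^-1 != 0.
Proof. by rewrite invr_eq0 gm_neq0. Qed.
Definition gm_inv (x : Gm) : Gm := MkGm (gm_inv_neq0 x).

Fact gm_mulA : associative gm_mul.
Proof. by move=> x y z; apply: val_inj => /=; exact: mulrA. Qed.
Fact gm_mulC : commutative gm_mul.
Proof. by move=> x y; apply: val_inj => /=; exact: mulrC. Qed.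
Fact gm_mul1 : left_id gm_one gm_mul.
Proof. by move=> x; apply: val_inj => /=; exact: mul1r. Qed.
Fact gm_mulV : left_inverse gm_one gm_inv gm_mul.
Proof. by move=> x; apply: val_inj => /=; rewrite mulVf // gm_neq0. Qed.

HB.instance Definition _ :=
  GRing.isZmodule.Build Gm gm_mulA gm_mulC gm_mul1 gm_mulV.
HB.instance Definition _ := isPointed.Build Gm 0.
HB.instance Definition _ := DiscreteUniform.copy Gm (discrete_topology Gm).

Fact gm_sub_continuous : continuous (fun x : Gm * Gm => x.1 - x.2).
Proof.
move=> [x y] A /= /nbhs_singleton /= Axy.
exists ([set x], [set y]) => /=; first by split; exact: discrete_set1.
by move=> [a b] /= [-> ->].
Qed.
HB.instance Definition _ :=
  PreTopologicalNmodule_isTopologicalZmodule.Build Gm gm_sub_continuous.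

Definition toGm (x : K) : Gm := insubd (0 : Gm) x.

End MultiplicativeGroup.

(* Topological abelian groups on which a group acts by continuous
   automorphisms; joint continuity is the separate [continuous_action]. *)
Record gmodule (G : groupType) := MkGmodule {
  gm_car :> topologicalZmodType;
  act : G -> gm_car -> gm_car;
  act1 : forall a, act 1%g a = a;
  actM : forall s t a, act (s * t)%g a = act s (act t a);
  actB : forall s a b, act s (a - b) = act s a - act s b;
  act_continuous : forall s, continuous (act s) }.

Definition continuous_action (G : topGroupType) (A : gmodule G) :=
  continuous (fun x : G * A => act x.1 x.2).

Record gmor (G : groupType) (A B : gmodule G) := MkGmor {
  gmor_fun :> A -> B;
  gmorB : forall a b, gmor_fun (a - b) = gmor_fun a - gmor_fun b;
  gmor_act : forall s a, gmor_fun (act s a) = act s (gmor_fun a);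
  gmor_continuous : continuous gmor_fun }.

Section Cohomology.
Variables (G : topGroupType) (A : gmodule G).

Definition d1 (f : G -> A) (s t : G) : A :=
  act s (f t) - f (s * t)%g + f s.

Definition d2 (f : G -> G -> A) (s t u : G) : A :=
  act s (f t u) - f (s * t)%g u + f s (t * u)%g - f s t.

Definition continuous2 (f : G -> G -> A) :=
  continuous (fun x : G * G => f x.1 x.2).

Definition cocycle1 : {pred (G -> A)} := fun f =>
  `[< continuous f /\ forall s t, d1 f s t = 0 >].

Lemma act0 (s : G) : act s 0 = 0 :> A.
Proof. by rewrite -[X in act s X](subrr 0) actB subrr. Qed.

Lemma actN (s : G) (a : A) : act s (- a) = - act s a.
Proof. by rewrite -[in LHS](sub0r a) actB act0 sub0r. Qed.

Lemma actD (s : G) (a b : A) : act s (a + b) = act s a + act s b.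
Proof. by rewrite -{1}[b]opprK actB actN opprK. Qed.

Lemma continuous_subr (T : topologicalType) (f g : T -> A) :
  continuous f -> continuous g -> continuous (fun x => f x - g x).
Proof.
move=> fc gc x.
apply: (@continuous_comp _ _ _ (fun x => (f x, g x))
  (fun x : A * A => x.1 - x.2)); last exact: sub_continuous.
by apply: cvg_pair; [exact: fc | exact: gc].
Qed.

Lemma d1B (f g : G -> A) s t : d1 (f - g) s t = d1 f s t - d1 g s t.
Proof.
rewrite (_ : f - g = fun s => f s - g s) // /d1 actB !opprD !opprK.
by rewrite [X in X + _]addrACA [LHS]addrACA.
Qed.

Lemma d2B (f g : G -> G -> A) s t u :
  d2 (f - g) s t u = d2 f s t u - d2 g s t u.
Proof.
rewrite (_ : f - g = fun s t => f s t - g s t) // /d2 actB !opprD !opprK.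
by rewrite [X in X + _ + _]addrACA [X in X + _]addrACA [LHS]addrACA.
Qed.

Fact cocycle1_closed : zmod_closed cocycle1.
Proof.
split.
  apply/asboolP; split=> [x|s t]; first exact: cvg_cst.
  by rewrite /d1 [LHS]addr0 [LHS]subr0 act0.
move=> f g /asboolP[fc f1] /asboolP[gc g1]; apply/asboolP; split.
  exact: continuous_subr.
by move=> s t; rewrite d1B f1 g1 subrr.
Qed.
HB.instance Definition _ := GRing.isZmodClosed.Build _ cocycle1 cocycle1_closed.

Record Z1 := MkZ1 { z1_fun :> G -> A; _ : z1_fun \in cocycle1 }.
HB.instance Definition _ := [isSub for z1_fun].
HB.instance Definition _ := [Choice of Z1 by <:].
HB.instance Definition _ := [SubChoice_isSubZmodule of Z1 by <:].

Definition coboundary1 : {pred Z1} := fun z =>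
  `[< exists a, forall s, z s = act s a - a >].

Fact coboundary1_closed : zmod_closed coboundary1.
Proof.
split; first by apply/asboolP; exists 0 => s; rewrite act0 subrr.
move=> f g /asboolP[a fa] /asboolP[b gb]; apply/asboolP; exists (a - b) => s.
by rewrite (_ : (f - g) s = f s - g s) // fa gb actB !opprD !opprK addrACA.
Qed.
HB.instance Definition _ :=
  GRing.isZmodClosed.Build _ coboundary1 coboundary1_closed.

Definition H1 : zmodType := Quotient.quot coboundary1.
Definition cls1 (z : Z1) : H1 := \pi_(Quotient.quot coboundary1)%qT z.
Definition rep1 (c : H1) : Z1 := repr (c : Quotient.quot coboundary1).

Definition cocycle2 : {pred (G -> G -> A)} := fun f =>
  `[< continuous2 f /\ forall s t u, d2 f s t u = 0 >].

Fact cocycle2_closed : zmod_closed cocycle2.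
Proof.
split.
  apply/asboolP; split=> [x|s t u]; first exact: cvg_cst.
  by rewrite /d2 [LHS]subr0 [LHS]addr0 [LHS]subr0 act0.
move=> f g /asboolP[fc f1] /asboolP[gc g1]; apply/asboolP; split.
  exact: (@continuous_subr _ (fun x : G * G => f x.1 x.2)).
by move=> s t u; rewrite d2B f1 g1 subrr.
Qed.
HB.instance Definition _ := GRing.isZmodClosed.Build _ cocycle2 cocycle2_closed.

Record Z2 := MkZ2 { z2_fun :> G -> G -> A; _ : z2_fun \in cocycle2 }.
HB.instance Definition _ := [isSub for z2_fun].
HB.instance Definition _ := [Choice of Z2 by <:].
HB.instance Definition _ := [SubChoice_isSubZmodule of Z2 by <:].

Definition coboundary2 : {pred Z2} := fun z =>
  `[< exists2 f : G -> A, continuous f & forall s t, z s t = d1 f s t >].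

Fact coboundary2_closed : zmod_closed coboundary2.
Proof.
split.
  apply/asboolP; exists (fun=> 0) => [x|s t]; first exact: cvg_cst.
  by rewrite /d1 act0 [RHS]addr0 subr0.
move=> z w /asboolP[f fc fz] /asboolP[g gc gw]; apply/asboolP.
exists (f - g) => [|s t]; first exact: continuous_subr.
by rewrite d1B -fz -gw.
Qed.
HB.instance Definition _ :=
  GRing.isZmodClosed.Build _ coboundary2 coboundary2_closed.

Definition H2 : zmodType := Quotient.quot coboundary2.

(* The class of a cochain; meaningful only when it is a continuous cocycle. *)
Definition cls2 (f : G -> G -> A) : H2 :=
  \pi_(Quotient.quot coboundary2)%qT (insubd (0 : Z2) f).

End Cohomology.

Section Functoriality.

Section Map.
Variables (G : topGroupType) (A B : gmodule G) (f : gmor A B).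

Lemma gmor0 : f 0 = 0.
Proof. by rewrite -[X in f X](subrr 0) gmorB subrr. Qed.

Lemma gmorN a : f (- a) = - f a.
Proof. by rewrite -[in LHS](sub0r a) gmorB gmor0 sub0r. Qed.

Lemma gmorD a b : f (a + b) = f a + f b.
Proof. by rewrite -{1}[b]opprK gmorB gmorN opprK. Qed.

Fact Z1map_subproof (z : Z1 A) : (fun s => f (z s)) \in @cocycle1 G B.
Proof.
case: z => z /= /asboolP[zc z1]; apply/asboolP; split=> [x|s t].
  by apply: continuous_comp; [exact: zc | exact: gmor_continuous].
by rewrite /d1 -gmor_act -gmorB -gmorD [X in f X]z1 gmor0.
Qed.
Definition Z1map (z : Z1 A) : Z1 B := MkZ1 (Z1map_subproof z).
Definition H1map (c : H1 A) : H1 B := cls1 (Z1map (rep1 c)).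

End Map.

(* Continuous homomorphisms of topological groups. *)
Record ghom (G' G : topGroupType) := MkGhom {
  ghom_fun :> G' -> G;
  ghomM : forall s t, ghom_fun (s * t)%g = (ghom_fun s * ghom_fun t)%g;
  ghom_continuous : continuous ghom_fun }.

Section Restriction.
Variables (G' G : topGroupType) (r : ghom G' G).

Lemma ghom1 : r 1%g = 1%g.
Proof. by apply: (mulgI (r 1%g)); rewrite -ghomM !mulg1. Qed.

Section Module.
Variable A : gmodule G.

Fact res_act1 (a : A) : act (r 1%g) a = a.
Proof. by rewrite ghom1 act1. Qed.

Fact res_actM s t (a : A) : act (r (s * t)%g) a = act (r s) (act (r t) a).
Proof. by rewrite ghomM actM. Qed.

Definition res_module : gmodule G' :=
  MkGmodule res_act1 res_actM (fun s => actB (r s))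
    (fun s => @act_continuous _ A (r s)).

Fact Z1res_subproof (z : Z1 A) : (fun s => z (r s)) \in @cocycle1 G' res_module.
Proof.
case: z => z /= /asboolP[zc z1]; apply/asboolP; split=> [x|s t].
  by apply: continuous_comp; [exact: ghom_continuous | exact: zc].
by rewrite -[RHS](z1 (r s) (r t)) /d1 ghomM.
Qed.
Definition Z1res (z : Z1 A) : Z1 res_module := MkZ1 (Z1res_subproof z).
Definition H1res (c : H1 A) : H1 res_module := cls1 (Z1res (rep1 c)).

End Module.

Definition res_mor (A B : gmodule G) (f : gmor A B) :
    gmor (res_module A) (res_module B) :=
  @MkGmor G' (res_module A) (res_module B) f (gmorB f)
    (fun s => gmor_act f (r s)) (@gmor_continuous _ _ _ f).

End Restriction.

End Functoriality.

Section Dual.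
Variables (K L : fieldType) (i : {rmorphism K -> L}).

Fact gm_act_neq0 (s : gal i) (x : Gm L) : s (x : L) != 0.
Proof.
have [sB [_ sM] /bij_inj sI _] := galP s; have := gm_neq0 x.
have s0 : s 0 = 0 by rewrite -[X in s X](subrr 0) sB subrr.
by apply: contra => /eqP sx; apply/eqP/sI; rewrite sx s0.
Qed.
Definition gm_act (s : gal i) (x : Gm L) : Gm L := MkGm (gm_act_neq0 s x).

Fact gm_act1 x : gm_act 1%g x = x.
Proof. exact: val_inj. Qed.
Fact gm_actM s t x : gm_act (s * t)%g x = gm_act s (gm_act t x).
Proof. exact: val_inj. Qed.
Fact gm_actB s x y : gm_act s (x - y) = gm_act s x - gm_act s y.
Proof.
have [sB [s1 sM] /bij_inj sI _] := galP s.
apply: val_inj => /=; rewrite sM; congr (_ * _).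
apply: (mulfI (gm_act_neq0 s y)); rewrite -sM !mulfV ?gm_neq0 ?gm_act_neq0 //.
Qed.
Fact gm_act_continuous s : continuous (gm_act s).
Proof. by move=> x A /nbhs_singleton Ax; apply: (@filterS _ (nbhs x) _ [set x]) (discrete_set1 x) => _ ->. Qed.

Definition Gm_module : gmodule (gal i) :=
  MkGmodule gm_act1 gm_actM gm_actB gm_act_continuous.

Variable A : gmodule (gal i).

Definition character : {pred (A -> Gm L)} := fun f =>
  `[< continuous f /\ forall a b, f (a - b) = f a - f b >].

Fact character_closed : zmod_closed character.
Proof.
split; first by apply/asboolP; split=> [x|a b]; [exact: cvg_cst | exact/esym/subrr].
move=> f g /asboolP[fc fB] /asboolP[gc gB]; apply/asboolP; split.
  exact: (@continuous_subr _ Gm_module).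
move=> a b; rewrite (_ : f - g = fun a => f a - g a) // fB gB.
by rewrite !opprD !opprK addrACA.
Qed.
HB.instance Definition _ := GRing.isZmodClosed.Build _ character character_closed.

Record dual := MkDual { dual_fun :> A -> Gm L; _ : dual_fun \in character }.
HB.instance Definition _ := [isSub for dual_fun].
HB.instance Definition _ := [Choice of dual by <:].
HB.instance Definition _ := [SubChoice_isSubZmodule of dual by <:].
HB.instance Definition _ := Topological.copy dual
  (initial_topology (dual_fun : dual -> {compact-open, A -> Gm L})).

Lemma nbhs_dual (f : dual) (C : set A) : compact C ->
  nbhs f [set g : dual | forall a, C a -> g a = f a].
Proof.
move=> Cc; have [fc _] : continuous f /\ forall a b, f (a - b) = f a - f b.
  by case: f => f /= /asboolP.
pose f' : {compact-open, A -> Gm L} := dual_fun f.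
have FF : Filter (nbhs f') := nbhs_filter f'.
have [/(_ (fun _ => id)) /fam_cvgP /(_ C Cc) ff _] :=
  compact_open_fam_compactP fc FF.
have /ff fC : nbhs (f : {uniform` C -> Gm L}) [set g | forall a, C a -> f a = g a].
  apply/uniform_nbhs; exists diagonal; split=> //.
  by rewrite uniform_discrete => _ [x _ <-].
have fC' : nbhs f (dual_fun @^-1` [set g | forall a, C a -> f a = g a]) :=
  @initial_continuous _ _
    (dual_fun : dual -> {compact-open, A -> Gm L}) f _ fC.
apply: (@filterS _ (nbhs f) (nbhs_filter f) _ _ _ fC').
by move=> g /= gf a Ca; rewrite -gf.
Qed.

Fact dual_sub_continuous : continuous (fun x : dual * dual => x.1 - x.2).
Proof.
apply: continuous_comp_initial => -[f g].
apply/compact_open_cvgP => C O Cc Oo fgO.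
exists ([set h : dual | forall a, C a -> h a = f a],
        [set h : dual | forall a, C a -> h a = g a]).
  by split; exact: nbhs_dual.
move=> [h k] [/= hf kg] _ [a Ca <-].
apply: fgO; exists a => //.
by rewrite -[LHS]/(f a - g a) -[RHS]/(h a - k a) hf // kg.
Qed.
HB.instance Definition _ :=
  PreTopologicalNmodule_isTopologicalZmodule.Build dual dual_sub_continuous.

Fact dual_act_subproof (s : gal i) (f : dual) :
  (fun a => gm_act s (f (act s^-1%g a))) \in character.
Proof.
case: f => f /= /asboolP[fc fB]; apply/asboolP; split=> [x|a b].
  apply: continuous_comp; last exact: gm_act_continuous.
  by apply: continuous_comp; [exact: act_continuous | exact: fc].
by rewrite actB fB gm_actB.
Qed.
Definition dual_act (s : gal i) (f : dual) : dual :=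
  MkDual (dual_act_subproof s f).

Lemma dual_eq (f g : dual) : f =1 g -> f = g.
Proof. by move=> fg; apply: val_inj; exact: funext. Qed.

Fact dual_act1 f : dual_act 1%g f = f.
Proof. by apply: dual_eq => a /=; rewrite invg1 act1 gm_act1. Qed.
Fact dual_actM s t f : dual_act (s * t)%g f = dual_act s (dual_act t f).
Proof. by apply: dual_eq => a /=; rewrite invgM actM gm_actM. Qed.
Fact dual_actB s f g : dual_act s (f - g) = dual_act s f - dual_act s g.
Proof. by apply: dual_eq => a; exact: gm_actB. Qed.
Fact dual_act_continuous s : continuous (dual_act s).
Proof.
apply: continuous_comp_initial => f.
have FF := fmap_filter (dual_fun \o dual_act s) (nbhs_filter f).
apply/compact_open_cvgP => C O Cc Oo fO.
have Cc' : compact (act s^-1%g @` C).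
  apply: continuous_compact Cc; apply: continuous_subspaceT.
  exact: act_continuous.
apply: (@filterS _ (nbhs f) (nbhs_filter f) _ _ _ (nbhs_dual f Cc')).
move=> g gf _ [a Ca <-].
apply: fO; exists a => //=; congr gm_act; rewrite gf //; by exists a.
Qed.

Definition dual_module : gmodule (gal i) :=
  MkGmodule dual_act1 dual_actM dual_actB dual_act_continuous.

End Dual.

Section AbsoluteValues.
Variables (R : realType) (K : fieldType).
Implicit Types a b : K -> R.

Definition absval a :=
  [/\ forall x, 0 <= a x, forall x, a x = 0 <-> x = 0,
      {morph a : x y / x * y} & forall x y, a (x + y) <= a x + a y].

Definition nontrivial a := exists2 x, x != 0 & a x != 1.

Definition absval_equiv a b := exists2 s, 0 < s & forall x, b x = a x `^ s.

Definition nonarchimedean a := forall x y, a (x + y) <= Num.max (a x) (a y).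

Definition complete_absval a := forall u : nat -> K,
  (forall e, 0 < e -> exists N : nat, forall m n : nat,
     (N <= m)%N -> (N <= n)%N -> a (u m - u n) < e) ->
  exists x, forall e, 0 < e -> exists N : nat, forall n : nat,
    (N <= n)%N -> a (u n - x) < e.

Definition residue_card a (q : nat) := exists e : 'I_q -> K,
  (forall k, a (e k) <= 1) /\
  (forall x, a x <= 1 -> exists! k, a (x - e k) < 1).

Definition uniformizer a (w : K) :=
  [/\ w != 0, a w < 1 & forall x, a x < 1 -> a x <= a w].

Definition place_pred : pred (set (K -> R)) := fun v =>
  `[< exists a, [/\ absval a, nontrivial a
                  & v = [set b | absval b /\ absval_equiv a b]] >].

End AbsoluteValues.

(* A place is an equivalence class of nontrivial absolute values. *)
Record place (R : realType) (F : fieldType) :=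
  MkPlace { place_set : set (F -> R); _ : place_pred place_set }.
HB.instance Definition _ R F := [isSub for @place_set R F].
HB.instance Definition _ R F := [Choice of place R F by <:].

Section Places.
Variables (R : realType) (F Fs : fieldType) (j : {rmorphism F -> Fs}).

(* A completion F_v of F at v, a separable closure of F_v, an embedding of Fs
   into it over F, and the induced homomorphism of absolute Galois groups. *)
Record local_datum (v : place R F) := LocalDatum {
  Fv : fieldType;
  Fv_abs : Fv -> R;
  Fv_in : {rmorphism F -> Fv};
  Fv_absP : absval Fv_abs;
  Fv_place : place_set v (Fv_abs \o Fv_in);
  Fv_dense : forall x e, 0 < e -> exists y, Fv_abs (x - Fv_in y) < e;
  Fv_complete : complete_absval Fv_abs;
  Fvs : fieldType;
  Fvs_in : {rmorphism Fv -> Fvs};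
  Fvs_closure : separable_closure Fvs_in;
  Fvs_abs : Fvs -> R;
  Fvs_absP : absval Fvs_abs;
  Fvs_abs_in : forall x, Fvs_abs (Fvs_in x) = Fv_abs x;
  loc_in : {rmorphism Fs -> Fvs};
  loc_in_F : forall x, loc_in (j x) = Fvs_in (Fv_in x);
  loc_gal : ghom (gal Fvs_in) (gal j);
  loc_galE : forall s x, loc_in (loc_gal s x) = s (loc_in x) }.

Section LocalField.
Variables (v : place R F) (D : local_datum v).

Notation Gv := (gal (Fvs_in D)).

Definition finite_place := nonarchimedean (@Fv_abs v D).

(* All of G_v when v is archimedean. *)
Definition inertia : set Gv := [set s : Gv | finite_place ->
  forall x, Fvs_abs x <= 1 -> Fvs_abs (s x - x) < 1].

Notation H2v := (H2 (Gm_module (Fvs_in D))).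

(* s acts as the (k s)-th power of the Frobenius x |-> x ^ q on the extension
   of degree n of the residue field, and k s < n. *)
Definition frobenius_exponent (q n : nat) (k : Gv -> nat) := forall s,
  (k s < n)%N /\
  forall x, Fvs_abs x <= 1 -> Fvs_abs (x ^+ (q ^ n) - x) < 1 ->
    Fvs_abs (s x - x ^+ (q ^ k s)) < 1.

(* The cocycle of the cyclic algebra of the unramified extension of degree n,
   its Frobenius and the uniformizer w; its invariant is 1 / n. *)
Definition fundamental_cocycle (n : nat) (w : Fv D) (k : Gv -> nat)
    (s t : Gv) : Gm_module (Fvs_in D) :=
  if (k s + k t < n)%N then 0 else toGm (Fvs_in D w).

(* The cocycle of Hamilton's quaternions, for G_v of order 2. *)
Definition quaternion_cocycle (s t : Gv) : Gm_module (Fvs_in D) :=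
  if (s == 1%g) || (t == 1%g) then 0 else toGm (-1).

(* These normalizations determine inv_v, since the fundamental classes
   generate H^2 of G_v in the units of F_v^s. *)
Definition invariant_map (inv : H2v -> QmodZ) :=
  [/\ forall c c', inv (c + c') = inv c + inv c',
      finite_place -> forall q n w k, residue_card (@Fv_abs v D) q ->
        (0 < n)%N -> uniformizer (@Fv_abs v D) w ->
        frobenius_exponent q n k ->
        inv (cls2 (fundamental_cocycle n w k)) = toModZ (n%:R^-1 : rat)
    & ~ finite_place -> (exists s : Gv, s != 1%g) ->
        inv (cls2 quaternion_cocycle) = toModZ (2^-1 : rat)].

Definition loc_module (A : gmodule (gal j)) : gmodule Gv :=
  res_module (loc_gal D) A.

(* H^1_ur(G_v, A) = ker (H^1(G_v, A) -> H^1(I_v, A)). *)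
Definition H1ur (A : gmodule (gal j)) : set (H1 (loc_module A)) :=
  [set c | exists2 z, c = cls1 z &
     exists a : loc_module A, forall s, inertia s -> z s = act s a - a].

Fact loc_gm_neq0 (x : Gm Fs) : loc_in D (x : Fs) != 0.
Proof. by rewrite fmorph_eq0 gm_neq0. Qed.
Definition loc_gm (x : Gm Fs) : Gm_module (Fvs_in D) := MkGm (loc_gm_neq0 x).

(* x \cup_A y, with values in the units of F_v^s. *)
Definition loc_cup (A : gmodule (gal j)) (x : Gv -> A) (y : Gv -> dual_module A)
    (s t : Gv) : Gm_module (Fvs_in D) :=
  loc_gm ((act (loc_gal D s) (y t)) (x s)).

End LocalField.

Variable L : forall v : place R F, local_datum v.
Variable inv : forall v, H2 (Gm_module (Fvs_in (L v))) -> QmodZ.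

Notation Gv v := (gal (Fvs_in (L v))).

Section RestrictedProduct.
Variable A : gmodule (gal j).

Record rprod := MkRprod {
  rprod_fun :> forall v, H1 (loc_module (L v) A);
  rprod_ur : finite_set [set v | ~ H1ur (rprod_fun v)] }.

Lemma rprod_eq (x y : rprod) : (forall v, x v = y v) -> x = y.
Proof.
case: x y => [x xc] [y yc] /= xy.
have {}xy : x = y by exact: functional_extensionality_dep.
by case: _ / xy yc => yc; congr MkRprod; exact: Prop_irrelevance.
Qed.

HB.instance Definition _ := gen_eqMixin rprod.
HB.instance Definition _ := gen_choiceMixin rprod.

Lemma H1ur0 v : H1ur (0 : H1 (loc_module (L v) A)).
Proof.
exists 0; first by rewrite /cls1 raddf0.
by exists 0 => s _; rewrite act0 subrr.
Qed.

Lemma H1urB v (c d : H1 (loc_module (L v) A)) :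
  H1ur c -> H1ur d -> H1ur (c - d).
Proof.
move=> [z -> [a za]] [w -> [b wb]]; exists (z - w); first by rewrite /cls1 raddfB.
exists (a - b) => s Is; rewrite -[LHS]/(z s - w s) za // wb //.
by rewrite actB !opprD !opprK addrACA.
Qed.

Lemma H1urN v (c : H1 (loc_module (L v) A)) : H1ur c -> H1ur (- c).
Proof. by move=> uc; rewrite -sub0r; apply: H1urB => //; exact: H1ur0. Qed.

Fact rprod0_subproof :
  finite_set [set v | ~ H1ur (0 : H1 (loc_module (L v) A))].
Proof.
by apply: (sub_finite_set _ (finite_set0 _)) => v /=; apply; exact: H1ur0.
Qed.
Fact rprodN_subproof (x : rprod) : finite_set [set v | ~ H1ur (- x v)].
Proof.
apply: (sub_finite_set _ (rprod_ur x)) => v /= nxv ux; apply: nxv.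
exact: H1urN.
Qed.
Fact rprodD_subproof (x y : rprod) : finite_set [set v | ~ H1ur (x v + y v)].
Proof.
have xyf : finite_set ([set v | ~ H1ur (x v)] `|` [set v | ~ H1ur (y v)]).
  by rewrite finite_setU; split; exact: rprod_ur.
apply: (sub_finite_set _ xyf) => v /= nxy.
have [ux|nx] := pselect (H1ur (x v)); last by left.
right=> uy; apply: nxy; rewrite -[y v]opprK; apply: H1urB => //.
exact: H1urN.
Qed.

Definition rprod_zero : rprod := MkRprod rprod0_subproof.
Definition rprod_opp (x : rprod) : rprod := MkRprod (rprodN_subproof x).
Definition rprod_add (x y : rprod) : rprod := MkRprod (rprodD_subproof x y).

Fact rprod_addA : associative rprod_add.
Proof. by move=> x y z; apply: rprod_eq => v /=; exact: addrA. Qed.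
Fact rprod_addC : commutative rprod_add.
Proof. by move=> x y; apply: rprod_eq => v /=; exact: addrC. Qed.
Fact rprod_add0 : left_id rprod_zero rprod_add.
Proof. by move=> x; apply: rprod_eq => v /=; exact: add0r. Qed.
Fact rprod_addN : left_inverse rprod_zero rprod_opp rprod_add.
Proof. by move=> x; apply: rprod_eq => v /=; exact: addNr. Qed.
HB.instance Definition _ :=
  GRing.isZmodule.Build rprod rprod_addA rprod_addC rprod_add0 rprod_addN.

(* The restricted product topology for discrete groups H^1(G_v, A), generated
   by the products of arbitrary subsets for v in a finite set S and of H^1_ur
   for v outside S. *)
HB.instance Definition _ := isSubBaseTopological.Build rprod
  [set SU : set (place R F) * (forall v, set (H1 (loc_module (L v) A)))
     | finite_set SU.1]
  (fun SU => [set x : rprod | forall v,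
     (SU.1 v -> SU.2 v (x v)) /\ (~ SU.1 v -> H1ur (x v))]).

Definition subgroup_set (W : set rprod) :=
  W 0 /\ forall x y, W x -> W y -> W (x - y).

(* Sel(A, W) *)
Definition Sel (W : set rprod) : set (H1 A) :=
  [set c | exists2 x, W x & forall v, x v = H1res (loc_gal (L v)) c].

End RestrictedProduct.

(* Sum over all places, for a family with finite support. *)
Definition place_sum (x : place R F -> QmodZ) : QmodZ :=
  \sum_(v \in [set: place R F]) x v.

Section Pairing.
Variable A : gmodule (gal j).

Definition loc_pairing (x : rprod A) (y : rprod (dual_module A))
    (v : place R F) : QmodZ :=
  inv (cls2 (loc_cup (rep1 (x v)) (rep1 (y v)))).

(* The finiteness clause says that the sum over v makes sense; it always holds,
   as unramified classes annihilate each other at almost all places. *)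
Definition orthogonal_pair (x : rprod A) (y : rprod (dual_module A)) :=
  finite_set [set v | loc_pairing x y v != 0] /\
  place_sum (loc_pairing x y) = 0.

Definition orth (W : set (rprod A)) : set (rprod (dual_module A)) :=
  [set y | forall x, W x -> orthogonal_pair x y].

Definition orth_dual (W : set (rprod (dual_module A))) : set (rprod A) :=
  [set x | forall y, W y -> orthogonal_pair x y].

End Pairing.

Section RprodMap.
Variables (A B : gmodule (gal j)) (f : gmor A B).

Definition loc_map v : gmor (loc_module (L v) A) (loc_module (L v) B) :=
  res_mor (loc_gal (L v)) f.

Lemma H1map_ur v (c : H1 (loc_module (L v) A)) :
  H1ur c -> H1ur (H1map (loc_map v) c).
Proof.
move=> uc; exists (Z1map (loc_map v) (rep1 c)) => //.
have [z zc [a za]] := uc.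
have /eqP : cls1 (rep1 c) = cls1 z by rewrite -zc; exact: reprK.
rewrite /cls1 -Quotient.idealrBE.
move=> /asboolP [b zb]; exists (f (b + a)) => s Is.
rewrite /= -gmor_act -gmorB; congr (f _).
have {}zb : rep1 c s - z s = act s b - b := zb s.
by rewrite -[LHS](subrK (z s)) zb za // actD opprD addrACA.
Qed.

Fact rprod_map_subproof (x : rprod A) :
  finite_set [set v | ~ H1ur (H1map (loc_map v) (x v))].
Proof.
apply: (sub_finite_set _ (rprod_ur x)) => v /= nfx ux; apply: nfx.
exact: H1map_ur.
Qed.
Definition rprod_map (x : rprod A) : rprod B := MkRprod (rprod_map_subproof x).

End RprodMap.

End Places.

Section ThetaGroups.
Variables (F Fs : fieldType) (j : {rmorphism F -> Fs}) (A : gmodule (gal j)).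

Record theta_group := ThetaGroup {
  th_car :> topGroupType;
  th_mul_continuous : continuous (fun x : th_car * th_car => (x.1 * x.2)%g);
  th_inv_continuous : continuous (fun g : th_car => (g^-1)%g);
  th_act : gal j -> th_car -> th_car;
  th_act1 : forall g, th_act 1%g g = g;
  th_actM : forall s t g, th_act (s * t)%g g = th_act s (th_act t g);
  th_act_morph : forall s g h, th_act s (g * h)%g = (th_act s g * th_act s h)%g;
  th_act_continuous :
    continuous (fun x : gal j * th_car => th_act x.1 x.2);
  th_in : Gm Fs -> th_car;
  th_pi : th_car -> A;
  th_inM : forall x y, th_in (x + y) = (th_in x * th_in y)%g;
  th_piM : forall g h, th_pi (g * h)%g = th_pi g + th_pi h;
  th_in_act : forall s x, th_in (gm_act s x) = th_act s (th_in x);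
  th_pi_act : forall s g, th_pi (th_act s g) = act s (th_pi g);
  th_in_inj : injective th_in;
  th_exact : forall g, th_pi g = 0 <-> exists x, g = th_in x;
  th_pi_surj : forall a, exists g, th_pi g = a;
  th_central : forall x g, (th_in x * g)%g = (g * th_in x)%g;
  th_pi_continuous : continuous th_pi;
  th_pi_open : forall U, open U -> open (th_pi @` U);
  th_small_subgroup : exists U : set th_car,
    [/\ open U, U 1%g, forall g h, U g -> U h -> U (g * h^-1)%g
      & forall x, U (th_in x) -> x = 0] }.

(* f is the homomorphism f_H attached to the theta group H. *)
Definition theta_map (H : theta_group) (f : gmor A (dual_module A)) :=
  forall g h : H, (g * h * g^-1 * h^-1)%g = th_in H (f (th_pi h) (th_pi g)).

End ThetaGroups.

Section CasselsTate.
Variables (R : realType) (F Fs : fieldType) (j : {rmorphism F -> Fs}).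
Variable L : forall v : place R F, local_datum j v.
Variable inv : forall v, H2 (Gm_module (Fvs_in (L v))) -> QmodZ.

Notation GF := (gal j).
Notation Gv v := (gal (Fvs_in (L v))).

Section Quadratic.
Variables (A : gmodule GF) (H : theta_group A).

(* e is the value of q at c, computed with a cocycle a of class c and a
   continuous lift b of a to H. *)
Definition q_value v (c : H1 (loc_module (L v) A))
    (e : H2 (Gm_module (Fvs_in (L v)))) :=
  exists (a : Z1 (loc_module (L v) A)) (b : Gv v -> H)
         (u : Gv v -> Gv v -> Gm Fs),
  [/\ c = cls1 a, continuous b, forall s, th_pi (b s) = a s,
      forall s t, th_in H (u s t) =
        (b s * th_act (loc_gal (L v) s) (b t) * (b (s * t)%g)^-1)%g
    & e = cls2 (fun s t => loc_gm (L v) (u s t))].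

Definition q_loc v (c : H1 (loc_module (L v) A)) :
    H2 (Gm_module (Fvs_in (L v))) :=
  xget 0 [set e | q_value c e].

Definition q_locsum (x : rprod L A) : QmodZ :=
  place_sum (fun v => inv (q_loc (x v))).

End Quadratic.

Section Objects.
Variable A : gmodule GF.

Definition SMod (W : set (rprod L A)) :=
  [/\ continuous_action A,
      forall a : A, open [set a],
      exists n, ([set: A] #= `I_n)%card /\ forall p, p \in [pchar F] -> ~~ (p %| n)%N
    & [/\ compact W, open W & subgroup_set W]].

Section Zl_modules.
Variables (l : nat) (scal : Zl l -> A -> A).

Record Zl_action : Prop := {
  scal1 : forall a, scal 1 a = a;
  scalA : forall c d a, scal (c * d) a = scal c (scal d a);
  scalDl : forall c d a, scal (c + d) a = scal c a + scal d a;
  scalDr : forall c a b, scal c (a + b) = scal c a + scal c b;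
  scal_continuous : continuous (fun x : Zl l * A => scal x.1 x.2);
  scal_act : forall c s a, scal c (act s a) = act s (scal c a) }.

Definition fg_submodule (U : set A) := exists n (e : 'I_n -> A),
  (forall k, U (e k)) /\
  (forall a, U a -> exists c : 'I_n -> Zl l, a = \sum_k scal (c k) (e k)).

(* The Pontryagin dual of A / U, for U an open submodule of A, consists of the
   homomorphisms from A to R / Z which vanish on U. *)
Definition quotient_character (U : set A) (chi : A -> moduloZ R) :=
  (forall a b, chi (a + b) = chi a + chi b) /\ forall a, U a -> chi a = 0.

Definition fg_quotient_dual (U : set A) := exists n (e : 'I_n -> A -> moduloZ R),
  (forall k, quotient_character U (e k)) /\
  (forall chi, quotient_character U chi -> exists c : 'I_n -> Zl l,
     forall a, chi a = \sum_k e k (scal (c k) a)).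

Definition acceptable :=
  [/\ Zl_action, hausdorff_space A, continuous_action A,
      exists U : set A, [/\ open U, compact U,
          [/\ U 0, forall a b, U a -> U b -> U (a + b),
              forall c a, U a -> U (scal c a)
            & forall s a, U a -> U (act s a)],
          fg_submodule U & fg_quotient_dual U]
    & finite_set [set v | exists s, inertia s /\
        exists a : A, act (loc_gal (L v) s) a != a]].

Definition H1_scal v c (x y : H1 (loc_module (L v) A)) :=
  exists z w, [/\ x = cls1 z, y = cls1 w & forall s, w s = scal c (z s)].

Definition local_submodule (S : set (place R F))
    (WS : set (forall v : {v | S v}, H1 (loc_module (L (sval v)) A))) :=
  [/\ WS (fun=> 0),
      forall x y, WS x -> WS y -> WS (fun v => x v + y v)
    & forall c x y, WS x -> (forall v, H1_scal c (x v) (y v)) -> WS y].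

Definition SMod_inf (W : set (rprod L A)) :=
  acceptable /\ exists S WS, [/\ finite_set S, @local_submodule S WS
    & W = [set x | WS (fun v => x (sval v)) /\ forall v, ~ S v -> H1ur (x v)]].

End Zl_modules.

End Objects.

Section ExactSequence.
Variables (M1 M M2 : gmodule GF).
Variables (iota : gmor M1 M) (proj : gmor M M2).
Variables (W1 : set (rprod L M1)) (W : set (rprod L M)) (W2 : set (rprod L M2)).

Definition exact_with_conditions :=
  [/\ injective iota,
      forall m, proj m = 0 <-> exists m1, m = iota m1,
      forall m2, exists m, proj m = m2,
      W1 = rprod_map iota @^-1` W
    & W2 = rprod_map proj @` W].

Definition exact_SMod :=
  [/\ SMod W1, SMod W, SMod W2 & exact_with_conditions].

Definition exact_SMod_inf (l : nat) :=
  exists (scal1 : Zl l -> M1 -> M1) (scal : Zl l -> M -> M)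
         (scal2 : Zl l -> M2 -> M2),
  [/\ SMod_inf scal1 W1, SMod_inf scal W, SMod_inf scal2 W2,
      (forall c m, iota (scal1 c m) = scal c (iota m)) /\
      (forall c m, proj (scal c m) = scal2 c (proj m))
    & exact_with_conditions].

(* The choices in the definition of the Cassels-Tate pairing; ct_g stands for
   iota^-1 (d f) and ct_h for iota^-1 (f_v - phi_v). *)
Record CTP_choice (phi : H1 M2) (psi : H1 (dual_module M1)) := CTPChoice {
  ct_phi : Z1 M2;
  ct_phiP : cls1 ct_phi = phi;
  ct_psi : Z1 (dual_module M1);
  ct_psiP : cls1 ct_psi = psi;
  ct_f : GF -> M;
  ct_f_continuous : continuous ct_f;
  ct_fP : forall s, proj (ct_f s) = ct_phi s;
  ct_g : GF -> GF -> M1;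
  ct_gP : forall s t, iota (ct_g s t) = d1 ct_f s t;
  ct_eps : GF -> GF -> Gm_module j;
  ct_eps_continuous : continuous2 ct_eps;
  ct_epsP : forall s t u,
    d2 ct_eps s t u = (act (s * t)%g (ct_psi u) : dual_module M1) (ct_g s t);
  ct_loc : forall v, Z1 (loc_module (L v) M);
  ct_locP : forall v s, proj (ct_loc v s) = ct_phi (loc_gal (L v) s);
  ct_locW : exists2 x, W x & forall v, x v = cls1 (ct_loc v);
  ct_h : forall v, Gv v -> M1;
  ct_hP : forall v s, iota (ct_h s) =
    ct_f (loc_gal (L v) s) - ct_loc v s }.

Definition CTP_value phi psi (C : CTP_choice phi psi) : QmodZ :=
  place_sum (fun v => inv (cls2 (fun s t =>
    loc_cup (ct_h C (v := v)) (fun s => ct_psi C (loc_gal (L v) s)) s t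
    - loc_gm (L v) (ct_eps C (loc_gal (L v) s) (loc_gal (L v) t))))).

(* ctp is the Cassels-Tate pairing: its value is computed by the formula above
   for every choice. That such a map exists is its well-definedness. *)
Definition is_CTP (ctp : H1 M2 -> H1 (dual_module M1) -> QmodZ) :=
  forall phi psi, Sel W2 phi -> Sel (orth inv W1) psi ->
  forall C : CTP_choice phi psi, ctp phi psi = CTP_value C.

End ExactSequence.

Section PoonenStoll.
Variables (M1 M : gmodule GF) (iota : gmor M1 M) (H : theta_group M).

(* s is a continuous section of the projection from the preimage of iota(M1)
   in H to M1. *)
Definition theta_section (s : M1 -> H) :=
  [/\ continuous s, forall a b, s (a + b) = (s a * s b)%g
    & forall a, th_pi (s a) = iota a].

Definition PS_cocycle (s : M1 -> H) (psi : Z1 (dual_module M1)) :=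
  forall g m, th_in H (psi g m) =
    (th_act g (s (act g^-1%g m)) * (s m)^-1)%g.

End PoonenStoll.

End CasselsTate.

(* Main.v *)
Require Import Defs.
From mathcomp Require Import all_boot all_order all_algebra.
From mathcomp Require Import generic_quotient ring_quotient.
From mathcomp Require Import all_classical all_reals topology tvs function_spaces.
From mathcomp Require Import ring.

Set Implicit Arguments.
Unset Strict Implicit.
Unset Printing Implicit Defensive.

Import GRing.Theory.
Local Open Scope classical_set_scope.
Local Open Scope ring_scope.

(** The equality holds place by place.  Every element of [H] above [iota M1] is
    [s m * th_in x] for unique [m] and [x].  Lift the cocycle of [phi] to a
    cochain [f] in [M] and then to [B : G_F -> H], and let
    [dB = s g * th_in e], so that [iota g = df].  The action of [G_F] on [s]
    produces [psi_PS] and the commutator of [B] with [s] produces [f2 phi], so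
    [de] is, up to sign, the cup product of [psi = psi_PS - f2 phi] with [g], in
    the order opposite to the one of the Cassels-Tate pairing; the cup-1 product
    [psi(t u) (g(t, u))] exchanges the two orders, and [psi(t u) (g(t, u)) - e]
    is the global cochain [eps].  At a place [v], write [f_v = phi_v + iota h].
    Then [b = (s h)^-1 B] lifts [phi_v], and [h \cup psi - eps_v] is [db] up to
    the coboundary of [t |-> psi t (h t)].

    For [Z_l]-modules the cochains are continuous because [iota] is a
    topological embedding and [proj] has a continuous section.  Both follow from
    the fact that a closed submodule modulo which a finitely generated module is
    torsion is a neighbourhood of 0 in it. *)

(** * Topological preliminaries *)

Lemma continuous_op2 (T X Y Z : topologicalType) (op : X * Y -> Z)
    (f : T -> X) (g : T -> Y) :
  continuous op -> continuous f -> continuous g ->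
  continuous (fun t => op (f t, g t)).
Proof.
move=> opc fc gc t; apply: (@continuous_comp _ _ _ (fun t => (f t, g t)) op).
  by apply: cvg_pair; [exact: fc | exact: gc].
exact: opc.
Qed.

Lemma continuous_fst (X Y : topologicalType) : continuous (@fst X Y).
Proof. by move=> [x y]; exact: cvg_fst. Qed.

Lemma continuous_snd (X Y : topologicalType) : continuous (@snd X Y).
Proof. by move=> [x y]; exact: cvg_snd. Qed.

Lemma continuous_add (V : topologicalZmodType) (T : topologicalType)
    (f g : T -> V) :
  continuous f -> continuous g -> continuous (fun t => f t + g t).
Proof. by move=> fc gc; exact: (continuous_op2 (@add_continuous V) fc gc). Qed.

Lemma continuous_opp (V : topologicalZmodType) (T : topologicalType)
    (f : T -> V) : continuous f -> continuous (fun t => - f t).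
Proof.
by move=> fc t; apply: continuous_comp; [exact: fc | exact: opp_continuous].
Qed.

Lemma continuous_sub (V : topologicalZmodType) (T : topologicalType)
    (f g : T -> V) :
  continuous f -> continuous g -> continuous (fun t => f t - g t).
Proof. by move=> fc gc; exact: (continuous_op2 (@sub_continuous V) fc gc). Qed.

Lemma continuous_compose (X Y Z : topologicalType) (g : Y -> Z) (f : X -> Y) :
  continuous g -> continuous f -> continuous (fun x => g (f x)).
Proof. by move=> gc fc x; apply: continuous_comp; [exact: fc | exact: gc]. Qed.

Lemma continuous_cst (T U : topologicalType) (u : U) :
  continuous (fun _ : T => u).
Proof. by move=> t; exact: cvg_cst. Qed.

Lemma nbhs_shift (V : topologicalZmodType) (a : V) (O : set V) :
  nbhs a O -> nbhs (0 : V) [set x | O (a + x)].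
Proof.
move=> aO; have := @continuous_add V V (fun=> a) id.
move=> /(_ (fun _ => cvg_cst _) (fun _ => cvg_id) (0 : V)); apply.
by rewrite addr0.
Qed.

Lemma nbhs_unshift (V : topologicalZmodType) (a : V) (O : set V) :
  nbhs (0 : V) O -> nbhs a [set x | O (x - a)].
Proof.
move=> aO; have := @continuous_sub V V id (fun=> a).
move=> /(_ (fun _ => cvg_id) (fun _ => cvg_cst _) a); apply.
by rewrite subrr.
Qed.

Lemma prod_cvg (I : Type) (K : I -> topologicalType)
    (F : set_system (prod_topology K)) (f : prod_topology K) :
  Filter F -> (forall i, (fun g : prod_topology K => g i) @ F --> f i) ->
  F --> f.
Proof.
move=> FF Ff; apply/cvg_sup => i A /= [_ [[B Bop <-] Bfs sBfA]].
by apply: filterS sBfA _; apply: (Ff i); exact: open_nbhs_nbhs.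
Qed.

Section LocallyConstant.
Variables (T : topologicalType) (K : fieldType).

Lemma continuous_GmP (f : T -> Gm K) :
  continuous f <-> forall t, \forall t' \near t, f t' = f t.
Proof.
split=> [fc t|fl t A /nbhs_singleton Aft].
  by have /(_ [set f t] (discrete_set1 _)) := fc t.
have ft := fl t; rewrite /nbhs/=; near=> t' => /=.
by rewrite (_ : f t' = f t) //; near: t'.
Unshelve. all: by end_near. Qed.

End LocallyConstant.

(** * The Krull topology on Galois groups *)

Section GaloisTopology.
Variables (K L : fieldType) (i : {rmorphism K -> L}).
Implicit Types s : gal i.

Lemma gal_near s (x : L) : nbhs s [set s' : gal i | s' x = s x].
Proof.
pose T := prod_topology (fun _ : L => discrete_topology L).
have c1 : continuous (fun s : gal i => (s : T) x : discrete_topology L).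
  apply: (@continuous_compose _ T _ (fun g : T => g x)).
    exact: (@proj_continuous _ (fun _ : L => discrete_topology L)).
  exact: initial_continuous.
exact: (c1 s [set s x] (discrete_set1 _)).
Qed.

Lemma gal_continuousP (T : topologicalType) (f : T -> gal i) :
  (forall t x, \forall t' \near t, f t' x = f t x) -> continuous f.
Proof.
move=> fl; apply: continuous_comp_initial => t.
apply: prod_cvg => x A /nbhs_singleton Aft.
have ft := fl t x; rewrite /nbhs/=; near=> t' => /=.
by rewrite (_ : f t' x = f t x) //; near: t'.
Unshelve. all: by end_near. Qed.

Lemma gal_mul_continuous : continuous (fun x : gal i * gal i => (x.1 * x.2)%g).
Proof.
apply: gal_continuousP => -[s t] x.
have h1 := @continuous_snd _ _ (s, t) _ (gal_near t x) :
  nbhs ((s, t) : gal i * gal i) [set p : gal i * gal i | p.2 x = t x].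
have h2 := @continuous_fst _ _ (s, t) _ (gal_near s (t x)) :
  nbhs ((s, t) : gal i * gal i) [set p : gal i * gal i | p.1 (t x) = s (t x)].
near=> p; rewrite -[LHS]/(p.1 (p.2 x)) -[RHS]/(s (t x)).
rewrite (_ : p.2 x = t x); last by near: p; exact: h1.
by near: p; exact: h2.
Unshelve. all: by end_near. Qed.

Lemma gal_inv_continuous : continuous (fun s : gal i => (s^-1)%g).
Proof.
apply: gal_continuousP => s x; rewrite /nbhs/=; near=> s'.
have s'x : s' ((s^-1)%g x) = x.
  rewrite -[RHS](@gal_invK _ _ i s x); near: s'; exact: gal_near.
by rewrite -{1}s'x; exact: gal_Kinv.
Unshelve. all: by end_near. Qed.

Lemma gm_act_continuous2 : continuous_action (Gm_module i).
Proof.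
apply/continuous_GmP => -[s x].
have h1 := @continuous_snd _ _ (s, x) _ (discrete_set1 x) :
  nbhs ((s, x) : gal i * Gm L) [set p : gal i * Gm L | p.2 = x].
have h2 := @continuous_fst _ _ (s, x) _ (gal_near s x) :
  nbhs ((s, x) : gal i * Gm L) [set p : gal i * Gm L | p.1 (x : L) = s (x : L)].
near=> p => /=.
rewrite (_ : p.2 = x); last by near: p; exact: h1.
by apply: val_inj => /=; near: p; exact: h2.
Unshelve. all: by end_near. Qed.

End GaloisTopology.

(** * Theta groups *)

Section ThetaGroup.
Variables (F Fs : fieldType) (j : {rmorphism F -> Fs}) (A : gmodule (gal j)).
Variable H : theta_group A.
Implicit Types (g h : H) (x y : Gm Fs).

Lemma th_in0 : th_in H 0 = 1%g.
Proof. by apply: (mulgI (th_in H 0)); rewrite -th_inM addr0 mulg1. Qed.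

Lemma th_inN x : th_in H (- x) = (th_in H x)^-1%g.
Proof. by apply: (mulgI (th_in H x)); rewrite -th_inM subrr th_in0 mulgV. Qed.

Lemma th_pi1 : th_pi (1%g : H) = 0.
Proof.
by apply: (addrI (th_pi (1%g : H))); rewrite -th_piM mulg1 addr0.
Qed.

Lemma th_piV g : th_pi (g^-1)%g = - th_pi g.
Proof. by apply: (addrI (th_pi g)); rewrite -th_piM mulgV th_pi1 subrr. Qed.

Lemma th_pi_in x : th_pi (th_in H x) = 0.
Proof. by apply/th_exact; exists x. Qed.

Lemma th_act_1 s : th_act s (1%g : H) = 1%g.
Proof.
by apply: (mulgI (th_act s 1%g)); rewrite -th_act_morph !mulg1.
Qed.

Lemma th_actV s g : th_act s (g^-1)%g = (th_act s g)^-1%g.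
Proof.
by apply: (mulgI (th_act s g)); rewrite -th_act_morph !mulgV th_act_1.
Qed.

Lemma th_pi_eq g h : th_pi g = th_pi h -> exists x, g = (th_in H x * h)%g.
Proof.
move=> gh; have /th_exact[x xE] : th_pi (g * h^-1)%g = 0.
  by rewrite th_piM th_piV gh subrr.
by exists x; rewrite -xE mulgVK.
Qed.

Section Continuity.
Variable T : topologicalType.

Lemma th_mulc (b c : T -> H) :
  continuous b -> continuous c -> continuous (fun t => (b t * c t)%g).
Proof. exact: (continuous_op2 (@th_mul_continuous _ _ _ _ H)). Qed.

Lemma th_invc (b : T -> H) : continuous b -> continuous (fun t => (b t)^-1%g).
Proof. exact: (continuous_compose (@th_inv_continuous _ _ _ _ H)). Qed.

Lemma th_actc (s : T -> gal j) (b : T -> H) :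
  continuous s -> continuous b -> continuous (fun t => th_act (s t) (b t)).
Proof. exact: (continuous_op2 (@th_act_continuous _ _ _ _ H)). Qed.

(* The small subgroup makes the image of [th_in] discrete. *)
Lemma th_in_continuousI (x : T -> Gm Fs) :
  continuous (fun t => th_in H (x t)) -> continuous x.
Proof.
move=> xc; apply/continuous_GmP => t.
have [U [Uo U1 _ U0]] := th_small_subgroup H.
have dc : continuous (fun t' => th_in H (x t') * (th_in H (x t))^-1)%g.
  by apply: th_mulc => // t'; exact: cvg_cst.
have UU : nbhs (th_in H (x t) * (th_in H (x t))^-1)%g U.
  by rewrite mulgV; exact: open_nbhs_nbhs.
have D := dc t U UU; near=> t'; apply/subr0_eq/U0; rewrite th_inM th_inN.
by near: t'; exact: D.
Unshelve. all: by end_near. Qed.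

End Continuity.

(* [th_pi] is a homeomorphism from the small subgroup to its image. *)
Lemma th_pi_section : exists2 r : A -> H,
  continuous r & forall a, th_pi (r a) = a.
Proof.
have [V [Vo V1 VB V0]] := th_small_subgroup H.
pose P : set A := @th_pi _ _ _ _ H @` V.
have Po : open P by exact: th_pi_open.
have PB a b : P a -> P b -> P (a - b).
  move=> [g Vg <-] [h Vh <-]; exists (g * h^-1)%g; first exact: VB.
  by rewrite th_piM th_piV.
have P0 : P 0 by exists 1%g => //; exact: th_pi1.
have VI g h : V g -> V h -> th_pi g = th_pi h -> g = h.
  move=> Vg Vh /th_pi_eq[x gE]; move: (VB _ _ Vg Vh); rewrite gE mulgK => /V0 ->.
  by rewrite th_in0 mul1g.
(* The set chosen from depends only on the coset of [a] modulo the open subgroup [P], so [rho] is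
   locally constant and subtracting [th_pi (rho a)] moves [a] into [P]. *)
pose rho a : H := xget 1%g [set g | P (a - th_pi g)].
have subBB a b c : b - c = (a - c) - (a - b) :> A.
  by rewrite opprB [RHS]addrC subrKA.
have rhoP a : P (a - th_pi (rho a)).
  rewrite /rho; case: xgetP => [g _ //|/=]; have [g <-] := th_pi_surj H a.
  by move=> /(_ g); rewrite subrr.
have rho_eq a b : P (a - b) -> rho a = rho b.
  move=> Pab; rewrite /rho; congr xget; apply/seteqP; split=> g /= Pg.
    by rewrite (subBB a b); exact: (PB).
  rewrite (subBB b a); apply: (PB) => //.
  by rewrite -(opprB a b) -sub0r; exact: (PB).
pose v a : H := xget 1%g [set g | V g /\ th_pi g = a - th_pi (rho a)].
have vP a : V (v a) /\ th_pi (v a) = a - th_pi (rho a).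
  rewrite /v; case: xgetP => [g _ //|]; have [g Vg gE] := rhoP a.
  by move=> /(_ g); case.
exists (fun a => v a * rho a)%g; last first.
  by move=> a; rewrite th_piM (vP a).2 subrK.
move=> a; have Pa : nbhs a [set b | P (b - a)].
  by apply: nbhs_unshift; exact: open_nbhs_nbhs.
suff vc : v @ a --> v a.
  have mc := @th_mul_continuous _ _ _ _ H (v a, rho a).
  have fc : ((fun b => v b * rho a) @ a --> v a * rho a)%g.
    apply: (@continuous_comp _ _ _ (fun b => (v b, rho a))
      (fun x : H * H => (x.1 * x.2)%g)); last exact: mc.
    by apply: cvg_pair => //; exact: cvg_cst.
  move=> O /fc; rewrite /nbhs/= => fO; near=> b => /=.
  rewrite (_ : rho b = rho a); first by near: b; exact: fO.
  by apply: rho_eq; near: b; exact: Pa.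
(* Openness of [th_pi] turns a neighbourhood of [v a] inside [V] into one of its image; injectivity
   on [V] then identifies the preimage found over a nearby [b] with [v b]. *)
move=> O; rewrite nbhsE => -[O' [O'o O'v] O'O].
have Wo : open (@th_pi _ _ _ _ H @` (O' `&` V)).
  by apply: th_pi_open; exact: openI.
have Wa : nbhs (a - th_pi (rho a)) (@th_pi _ _ _ _ H @` (O' `&` V)).
  apply: open_nbhs_nbhs; split => //; exists (v a); last exact: (vP a).2.
  by split=> //; exact: (vP a).1.
have sc : continuous (fun b : A => b - th_pi (rho a)).
  by apply: continuous_sub => b; [exact: cvg_id | exact: cvg_cst].
have {}Wa := sc a _ Wa.
rewrite /nbhs/=; near=> b => /=; apply: O'O.
have [g [O'g Vg] gE] :
    (@th_pi _ _ _ _ H @` (O' `&` V)) (b - th_pi (rho a)).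
  by near: b; exact: Wa.
have rhob : rho b = rho a by apply: rho_eq; near: b; exact: Pa.
have [Vb vb] := vP b; suff <- : g = v b by [].
by apply: VI => //; rewrite gE vb rhob.
Unshelve. all: by end_near. Qed.

End ThetaGroup.

Section DualModule.
Variables (K L : fieldType) (i : {rmorphism K -> L}) (A : gmodule (gal i)).
Implicit Types (x y : dual A) (a b : A).

Lemma dual_continuous x : continuous x.
Proof. by case: x => x /= /asboolP[]. Qed.

Lemma dualB x a b : x (a - b) = x a - x b.
Proof. by case: x => x /= /asboolP[_ xB]; exact: xB. Qed.

Lemma dual0 x : x 0 = 0.
Proof. by rewrite -[X in x X](subrr 0) dualB subrr. Qed.

Lemma dualN x a : x (- a) = - x a.
Proof. by rewrite -[in LHS](sub0r a) dualB dual0 sub0r. Qed.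

Lemma dualD x a b : x (a + b) = x a + x b.
Proof. by rewrite -{1}[b]opprK dualB dualN opprK. Qed.

Lemma dual_act_act s x a :
  (act s (x : dual_module A) : dual_module A) (act s a) = gm_act s (x a).
Proof. by rewrite /= -actM mulVg act1. Qed.

End DualModule.

Lemma cocycle1P (G : topGroupType) (A : gmodule G) (z : Z1 A) s t :
  z (s * t)%g = act s (z t) + z s.
Proof.
case: z => z /= /asboolP[_ /(_ s t)]; rewrite /d1 => z1; apply/eqP.
by rewrite eq_sym -subr_eq0 addrAC z1.
Qed.

Lemma Z1_continuous (G : topGroupType) (A : gmodule G) (z : Z1 A) :
  continuous z.
Proof. by case: z => z /= /asboolP[]. Qed.

(** * Cochains with values in a theta group *)

Section ThetaCochains.
Variables (F Fs : fieldType) (j : {rmorphism F -> Fs}).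
Variables (M1 M M2 : gmodule (gal j)) (iota : gmor M1 M) (proj : gmor M M2).
Variables (H : theta_group M) (fH : gmor M (dual_module M)).
Variables (f2 : gmor M2 (dual_module M1)) (s : M1 -> H).
Variable psiPS : Z1 (dual_module M1).
Hypothesis iotaI : injective iota.
Hypothesis fHP : theta_map H fH.
Hypothesis f2P : forall m m1, f2 (proj m) m1 = fH m (iota m1).
Hypothesis sP : theta_section iota s.
Hypothesis psiP : PS_cocycle s psiPS.
Implicit Types (g h b : H) (x y : Gm Fs) (m : M1).

(** Exchanging the two entries inverts a commutator. *)
Lemma theta_map_antisym (m n : M) : fH m n = - fH n m.
Proof.
have [[g <-] [h <-]] := (th_pi_surj H m, th_pi_surj H n).
apply: (@th_in_inj _ _ _ _ H); rewrite th_inN -!fHP.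
by rewrite !invgM !invgK !mulgA.
Qed.

(** Coordinates on the preimage of [iota M1]. Multiplication is addition in both of them; only the
    Galois action is twisted, by [psiPS]. *)
Definition theta_elt m x : H := (s m * th_in H x)%g.

Lemma theta_eltM m m' x x' :
  (theta_elt m x * theta_elt m' x')%g = theta_elt (m + m') (x + x').
Proof.
have [_ sD _] := sP; rewrite /theta_elt sD th_inM -!mulgA; congr (_ * _)%g.
by rewrite mulgA (th_central x (s m')) -mulgA.
Qed.

Lemma th_pi_theta_elt m x : th_pi (theta_elt m x) = iota m.
Proof. by have [_ _ spi] := sP; rewrite th_piM spi th_pi_in addr0. Qed.

Lemma theta_elt0 : theta_elt 0 0 = 1%g.
Proof.
have [_ sD _] := sP; rewrite /theta_elt th_in0 mulg1.
by apply: (mulgI (s 0)); rewrite -sD addr0 mulg1.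
Qed.

Lemma theta_eltI m m' x x' :
  theta_elt m x = theta_elt m' x' -> m = m' /\ x = x'.
Proof.
move=> E; have mm' : m = m'.
  by apply: iotaI; rewrite -(th_pi_theta_elt m x) E th_pi_theta_elt.
by split=> //; move: E; rewrite mm' => /mulgI/th_in_inj.
Qed.

Lemma th_in_theta_elt x : th_in H x = theta_elt 0 x.
Proof.
rewrite -[x in RHS]add0r -[X in theta_elt X](addr0 0) -theta_eltM theta_elt0.
have [_ sD _] := sP; rewrite mul1g /theta_elt.
by rewrite (_ : s 0 = 1%g) ?mul1g // -theta_elt0 /theta_elt th_in0 mulg1.
Qed.

Lemma theta_elt_act t m x : th_act t (theta_elt m x) =
  theta_elt (act t m) (gm_act t x + psiPS t (act t m)).
Proof.
have sact : th_act t (s m) = (s (act t m) * th_in H (psiPS t (act t m)))%g.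
  by rewrite -th_central psiP -actM mulVg act1 mulgVK.
by rewrite th_act_morph -th_in_act sact /theta_elt -mulgA -th_inM addrC.
Qed.

(** Passing [b] across [s m] costs their commutator, which [f2P] and antisymmetry express through
    [f2]. *)
Lemma theta_elt_conj b m x :
  (b * theta_elt m x)%g =
  (theta_elt m (x - f2 (proj (th_pi b)) m) * b)%g.
Proof.
have [_ _ spi] := sP.
have := fHP b (s m); rewrite spi theta_map_antisym -f2P => E.
have {}E : (b * s m = th_in H (- f2 (proj (th_pi b)) m) * s m * b)%g.
  by rewrite -E !mulgVK.
by rewrite /theta_elt mulgA E -(th_central x) !mulgA -th_inM th_central.
Qed.

(** Bracket the product of [B t], [t (B u)] and [(t * u) (B v)] in two ways and compare the second
    coordinates. The [psiPS] term arises when [t] acts on the element attached to [(u, v)], the [f2]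
    term when the result is moved across [B t]. *)
Lemma theta_cochain_d2 (B : gal j -> H) (g : gal j -> gal j -> M1)
    (e : gal j -> gal j -> Gm Fs) :
  (forall t u, (B t * th_act t (B u))%g =
               (theta_elt (g t u) (e t u) * B (t * u)%g)%g) ->
  forall t u v, e t u + e (t * u)%g v =
    gm_act t (e u v) + psiPS t (act t (g u v)) -
    f2 (proj (th_pi (B t))) (act t (g u v)) + e t (u * v)%g.
Proof.
move=> BP t u v.
suff /theta_eltI[] : theta_elt (g t u + g (t * u)%g v) (e t u + e (t * u)%g v) =
  theta_elt (act t (g u v) + g t (u * v)%g)
    (gm_act t (e u v) + psiPS t (act t (g u v)) -
     f2 (proj (th_pi (B t))) (act t (g u v)) + e t (u * v)%g) by [].
apply: (@mulIg _ (B (t * u * v)%g)); rewrite -!theta_eltM.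
rewrite -[LHS]mulgA -(BP (t * u)%g v) [LHS]mulgA -(BP t u).
rewrite -[RHS]mulgA -[in RHS](mulgA t) -(BP t) [RHS]mulgA -theta_elt_conj.
rewrite -theta_elt_act -[RHS]mulgA -th_act_morph -(BP u v) th_act_morph.
by rewrite -th_actM mulgA.
Qed.

(** Substitute [B = s h * b] in the product of [B t] and [t (B v)] and collect everything above
    [iota M1] on the left. The first coordinate says that [g] is the coboundary of [h], the second
    relates [e] to the defect [u] of [b]. *)
Lemma theta_cochain_local (G : topGroupType) (r : ghom G (gal j))
    (B b : G -> H) (g : G -> G -> M1) (e u : G -> G -> Gm Fs) (h : G -> M1) :
  (forall t v, (B t * th_act (r t) (B v))%g =
               (theta_elt (g t v) (e t v) * B (t * v)%g)%g) ->
  (forall t v, (b t * th_act (r t) (b v))%g =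
               (th_in H (u t v) * b (t * v)%g)%g) ->
  (forall t, B t = (s (h t) * b t)%g) ->
  forall t v, g t v = h t + act (r t) (h v) - h (t * v)%g /\
    e t v = psiPS (r t) (act (r t) (h v)) -
      f2 (proj (th_pi (b t))) (act (r t) (h v)) + u t v.
Proof.
move=> BP bP BE t v; have s0 m : s m = theta_elt m 0.
  by rewrite /theta_elt th_in0 mulg1.
have /theta_eltI[hg ->] : theta_elt (g t v + h (t * v)%g) (e t v) =
  theta_elt (h t + act (r t) (h v)) (psiPS (r t) (act (r t) (h v)) -
      f2 (proj (th_pi (b t))) (act (r t) (h v)) + u t v).
  apply: (@mulIg _ (b (t * v)%g)); rewrite -[e t v]addr0.
  rewrite -(theta_eltM (g t v)) -(s0 (h (t * v)%g)) -mulgA -BE -BP (BE t) (BE v).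
  rewrite th_act_morph (s0 (h v)) theta_elt_act.
  rewrite (_ : gm_act _ 0 = 0) ?add0r; last first.
    exact: (@act0 _ (Gm_module j)).
  rewrite mulgA -[(s (h t) * b t * _)%g]mulgA theta_elt_conj.
  rewrite -(mulgA (s (h t))) -(mulgA (theta_elt _ _)) bP.
  by rewrite (th_in_theta_elt (u t v)) (s0 (h t)) (mulgA (theta_elt (h t) _))
    theta_eltM mulgA theta_eltM addr0 add0r.
by rewrite -hg addrK.
Qed.
End ThetaCochains.

(** * Cup-1 products *)

Section CupOne.
Variables (K L : fieldType) (i : {rmorphism K -> L}) (A : gmodule (gal i)).
Variable psi : Z1 (dual_module A).

Lemma dual_cocycleE t u (a : A) :
  psi (t * u)%g a = (act t (psi u) : dual_module A) a + psi t a.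
Proof. by rewrite cocycle1P. Qed.

(* [(t, u) |-> psi (t * u) (g t u)] is the cup-1 product whose coboundary
   exchanges the two cup products of [g] and [psi]. *)
Lemma cup_one_d2 (g : gal i -> gal i -> A)
    (e : gal i -> gal i -> Gm_module i) :
  (forall t u v, d2 g t u v = 0) ->
  (forall t u v, e t u + e (t * u)%g v =
     gm_act t (e u v) + psi t (act t (g u v)) + e t (u * v)%g) ->
  forall t u v,
    @d2 _ (Gm_module i) (fun t u => psi (t * u)%g (g t u) - e t u) t u v =
    (act (t * u)%g (psi v) : dual_module A) (g t u).
Proof.
move=> dg de t u v.
(* The cocycle condition on [g], solved for the only term that involves the action. *)
have {}dg : act t (g u v) = g (t * u)%g v - g t (u * v)%g + g t u.
  have := dg t u v; rewrite /d2 => /eqP; rewrite subr_eq0 => /eqP <-.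
  by rewrite [RHS]addrC addrA addrAC addrK subrK.
have := dual_cocycleE (t * u)%g v (g t u).
have {de}:= de t u v.
have := dual_act_act t (psi (u * v)%g) (g u v).
have := dual_cocycleE t (u * v)%g (act t (g u v)).
have -> : @d2 _ (Gm_module i) (fun t u => psi (t * u)%g (g t u) - e t u) t u v =
    gm_act t (psi (u * v)%g (g u v)) - gm_act t (e u v) -
    (psi (t * u * v)%g (g (t * u)%g v) - e (t * u)%g v) +
    (psi (t * u * v)%g (g t (u * v)%g) - e t (u * v)%g) -
    (psi (t * u)%g (g t u) - e t u).
  by rewrite /d2 -gm_actB (mulgA t u v).
move=> E1 E2 E3 E4.
have {}E1 : gm_act t (psi (u * v)%g (g u v)) =
    psi (t * u * v)%g (act t (g u v)) - psi t (act t (g u v)).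
  by rewrite -E2 -(mulgA t u v) E1 addrK.
have {}E3 : gm_act t (e u v) =
    e t u + e (t * u)%g v - e t (u * v)%g - psi t (act t (g u v)).
  by rewrite E3 addrK addrK.
have {}E4 : (act (t * u)%g (psi v) : dual_module A) (g t u) =
    psi (t * u * v)%g (g t u) - psi (t * u)%g (g t u).
  by rewrite E4 addrK.
rewrite E1 E3 [RHS]E4 dg !dualD dualN.
(* Only a formal identity in the additively written group [Gm L] remains; [field] checks it
   multiplicatively in [L]. *)
move: (psi _ _) (psi _ _) (psi _ _) (psi _ _) (psi _ _) (psi _ _) (psi _ _)
  (e _ _ : Gm L) (e _ _ : Gm L) (e _ _ : Gm L) => a b c d p q r x y z.
by apply: val_inj => /=; field; rewrite !gm_neq0.
Qed.

(** Expand [psi (t * v)] by its cocycle condition: the cup product of [h] and [psi] cancels, the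
    product in the opposite order cancels against the one in [e], and a coboundary is left beside
    [u]. *)
Lemma cup_one_local (G : topGroupType) (r : ghom G (gal i)) (h : G -> A)
    (g : G -> G -> A) (e u : G -> G -> Gm L) :
  (forall t v, g t v = h t + act (r t) (h v) - h (t * v)%g) ->
  (forall t v, e t v = psi (r t) (act (r t) (h v)) + u t v) ->
  forall t v, (act (r t) (psi (r v)) : dual_module A) (h t) -
      (psi (r (t * v)%g) (g t v) - e t v) =
    u t v - (gm_act (r t) (psi (r v) (h v)) - psi (r (t * v)%g) (h (t * v)%g)
             + psi (r t) (h t)).
Proof.
move=> gE eE t v; rewrite gE eE -dual_act_act dualB dualD.
rewrite ghomM !(dual_cocycleE (r t) (r v)).
move: (psi _ _) (psi _ _) (psi _ _) (act _ (psi _) _) (act _ (psi _) _)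
  (act _ (psi _) _) (u _ _) => a b c p q x y.
by apply: val_inj => /=; field; rewrite !gm_neq0.
Qed.

End CupOne.

(** * Cohomology classes and local pairings *)

Section Classes.
Variables (G : topGroupType) (A : gmodule G).

Lemma cls1P (z w : Z1 A) :
  cls1 z = cls1 w <-> exists a, forall s, z s - w s = act s a - a.
Proof.
split=> [/eqP|[a za]].
  by rewrite /cls1 -Quotient.idealrBE => /asboolP.
by apply/eqP; rewrite /cls1 -Quotient.idealrBE; apply/asboolP; exists a.
Qed.

Lemma rep1K (c : H1 A) : cls1 (rep1 c) = c.
Proof. exact: reprK. Qed.

Lemma cls1B (z w : Z1 A) : cls1 (z - w) = cls1 z - cls1 w.
Proof. by rewrite /cls1 raddfB. Qed.

Lemma cocycle2P (f : G -> G -> A) : f \in @cocycle2 G A ->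
  continuous2 f /\ forall s t u, d2 f s t u = 0.
Proof. by move/asboolP. Qed.

(** [cls2] takes the default value 0 off the continuous cocycles, so computations with it must carry
    proofs of membership. *)
Lemma cls2E (f : G -> G -> A) (fz : f \in @cocycle2 G A) :
  cls2 f = \pi_(Quotient.quot (@coboundary2 G A))%qT (MkZ2 fz).
Proof. by rewrite /cls2; apply: congr1; apply: val_inj; rewrite insubdK. Qed.

Lemma cls2_eq (f g : G -> G -> A) (k : G -> A) :
  f \in @cocycle2 G A -> g \in @cocycle2 G A -> continuous k ->
  (forall s t, f s t - g s t = d1 k s t) -> cls2 f = cls2 g.
Proof.
move=> fz gz kc fg; rewrite !cls2E; apply/eqP; rewrite -Quotient.idealrBE.
by apply/asboolP; exists k.
Qed.

Lemma cls2B (f g : G -> G -> A) :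
  f \in @cocycle2 G A -> g \in @cocycle2 G A ->
  cls2 (fun s t => f s t - g s t) = cls2 f - cls2 g.
Proof.
move=> fz gz; have fgz : (fun s t => f s t - g s t) \in @cocycle2 G A.
  exact: (rpredB fz gz).
rewrite !cls2E -raddfB; apply: congr1; exact: val_inj.
Qed.

Lemma d1_cocycle2 (k : G -> A) :
  continuous (fun x : G * G => (x.1 * x.2)%g) -> continuous_action A ->
  continuous k -> d1 k \in @cocycle2 G A.
Proof.
move=> mc ac kc; apply/asboolP; split.
  apply: continuous_add.
    apply: continuous_sub; last exact: (continuous_compose kc mc).
    apply: (continuous_op2 ac); first exact: continuous_fst.
    exact: continuous_compose kc (@continuous_snd _ _).
  exact: continuous_compose kc (@continuous_fst _ _).
move=> s t u; rewrite /d2 /d1 actD actB actM (mulgA s t u) !opprD !opprK.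
(* The reordering places each of the twelve terms next to its negative. *)
rewrite !addrA [LHS](+%R.[ACl (1*4)*(2*7)*(3*10)*(5*8)*(6*11)*(9*12)]).
by rewrite !subrr !addNr !addr0.
Qed.

Lemma cls2_sub_d1 (f : G -> G -> A) (k : G -> A) :
  continuous (fun x : G * G => (x.1 * x.2)%g) -> continuous_action A ->
  f \in @cocycle2 G A -> continuous k ->
  cls2 (fun s t => f s t - d1 k s t) = cls2 f.
Proof.
move=> mc ac fz kc; apply/esym/(cls2_eq fz _ kc) => [|s t].
  exact: (rpredB fz (d1_cocycle2 mc ac kc)).
by rewrite opprB addrC subrK.
Qed.
End Classes.

Section Functorial.
Variables (G G' : topGroupType).

Lemma H1map_cls1 (A B : gmodule G) (f : gmor A B) (z : Z1 A) :
  H1map f (cls1 z) = cls1 (Z1map f z).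
Proof.
have /cls1P[a za] := rep1K (cls1 z).
apply/cls1P; exists (f a) => s /=.
by rewrite -gmorB za gmorB gmor_act.
Qed.

Lemma H1res_cls1 (r : ghom G' G) (A : gmodule G) (z : Z1 A) :
  H1res r (cls1 z) = cls1 (Z1res r z).
Proof.
have /cls1P[a za] := rep1K (cls1 z).
by apply/cls1P; exists a => s; exact: za.
Qed.

End Functorial.

(** * Evaluation of characters in the compact-open topology *)

Definition locally_compact_space (T : topologicalType) :=
  forall a : T, exists2 C, compact C & nbhs a C.

(** Take a compact neighbourhood [C] of [a]. Since [Gm L] is discrete, characters near [x] agree
    with [x] on all of [C], and [x] itself is locally constant. *)
Lemma dual_eval_continuous (K L : fieldType) (i : {rmorphism K -> L})
    (A : gmodule (gal i)) : locally_compact_space A ->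
  continuous (fun p : dual A * A => p.1 p.2).
Proof.
move=> lcA; apply/continuous_GmP => -[x a]; have [C Cc Ca] := lcA a.
have h1 := @continuous_fst _ _ (x, a) _ (nbhs_dual x Cc).
have h2 := @continuous_snd _ _ (x, a) _ Ca.
have h3 : nbhs a [set b | x b = x a].
  by have /continuous_GmP := @dual_continuous _ _ _ _ x; exact.
have {}h3 := @continuous_snd _ _ (x, a) _ h3.
near=> p => /=; have -> : p.1 p.2 = x p.2.
  have Cp : C p.2 by near: p; exact: h2.
  have : forall b, C b -> p.1 b = x b by near: p; exact: h1.
  exact.
by near: p; exact: h3.
Unshelve. all: by end_near. Qed.

Lemma dual_act_eval_continuous (K L : fieldType) (i : {rmorphism K -> L})
    (A : gmodule (gal i)) (T : topologicalType) (r : T -> gal i) (x : T -> A)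
    (y : T -> dual_module A) :
  locally_compact_space A -> continuous_action A ->
  continuous r -> continuous x -> continuous y ->
  continuous (fun t => (act (r t) (y t) : dual_module A) (x t)).
Proof.
move=> lcA acA rc xc yc.
apply: (continuous_op2 (@gm_act_continuous2 _ _ i) rc).
apply: (continuous_op2 (dual_eval_continuous lcA) yc).
apply: (continuous_op2 acA _ xc).
exact: continuous_compose (@gal_inv_continuous _ _ i) rc.
Qed.

(** * Local cup products and their classes *)

Section LocalCup.
Variables (R : realType) (F Fs : fieldType) (j : {rmorphism F -> Fs}).
Variables (v : place R F) (D : local_datum j v).
Notation Gv := (gal (Fvs_in D)).

Lemma loc_gmB x y : loc_gm D (x - y) = loc_gm D x - loc_gm D y.
Proof. by apply: val_inj => /=; rewrite fmorph_div. Qed.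

Lemma loc_gm0 : loc_gm D 0 = 0.
Proof. by rewrite -(subrr (0 : Gm Fs)) loc_gmB subrr. Qed.

Lemma loc_gmN x : loc_gm D (- x) = - loc_gm D x.
Proof. by rewrite -sub0r loc_gmB loc_gm0 sub0r. Qed.

Lemma loc_gmD x y : loc_gm D (x + y) = loc_gm D x + loc_gm D y.
Proof. by rewrite -{1}[y]opprK loc_gmB loc_gmN opprK. Qed.

Lemma loc_gm_act (s : Gv) x :
  act s (loc_gm D x) = loc_gm D (gm_act (loc_gal D s) x).
Proof. by apply: val_inj => /=; rewrite loc_galE. Qed.

Lemma loc_gm_continuous (T : topologicalType) (x : T -> Gm Fs) :
  continuous x -> continuous (fun t => loc_gm D (x t)).
Proof.
move=> /continuous_GmP xc; apply/continuous_GmP => t.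
by apply: filterS (xc t) => t' ->.
Qed.

Lemma Gv_cocycle2 (x : Gv -> Gv -> Gm Fs) :
  continuous (fun p : Gv * Gv => x p.1 p.2) ->
  (forall s t u, gm_act (loc_gal D s) (x t u) - x (s * t)%g u +
                 x s (t * u)%g - x s t = 0) ->
  (fun s t => loc_gm D (x s t)) \in @cocycle2 Gv (Gm_module (Fvs_in D)).
Proof.
move=> xc x0; apply/asboolP; split.
  exact: (loc_gm_continuous xc).
by move=> s t u; rewrite /d2 loc_gm_act -loc_gmB -loc_gmD -loc_gmB x0 loc_gm0.
Qed.

Section Cup.
Variable A : gmodule (gal j).
Hypothesis lcA : locally_compact_space A.
Hypothesis acA : continuous_action A.
Implicit Types (x : Z1 (loc_module D A)) (y : Z1 (loc_module D (dual_module A))).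

Lemma loc_cup_cocycle x y :
  loc_cup x y \in @cocycle2 Gv (Gm_module (Fvs_in D)).
Proof.
apply: Gv_cocycle2.
  apply: (dual_act_eval_continuous lcA acA).
  - exact: continuous_compose (@ghom_continuous _ _ (loc_gal D))
      (@continuous_fst _ _).
  - exact: continuous_compose (@Z1_continuous _ _ x) (@continuous_fst _ _).
  - exact: continuous_compose (@Z1_continuous _ _ y) (@continuous_snd _ _).
move=> s t u; pose r := loc_gal D; have xst := cocycle1P x s t.
have ytu := cocycle1P y t u.
rewrite -dual_act_act -actM -ghomM xst ytu dualD.
have -> : act (r s) (act t (y u) + y t) (x s) =
    act (r (s * t)%g) (y u) (x s) + act (r s) (y t) (x s).
  by rewrite actD ghomM actM.
apply/eqP; rewrite subr_eq0; apply/eqP.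
have cancel (a b c : Gm Fs) : a - (a + b) + (b + c) = c.
  by rewrite opprD [a + _]addrA subrr sub0r addKr.
exact: cancel.
Qed.

Lemma loc_cup_coboundaryl (a : A) (x : Gv -> A) y :
  (forall s, x s = act (loc_gal D s) a - a) ->
  forall s t, loc_cup x y s t =
    @d1 _ (Gm_module (Fvs_in D)) (fun s => loc_gm D (y s a)) s t.
Proof.
move=> xE s t; rewrite /d1 loc_gm_act -loc_gmB -loc_gmD; congr (loc_gm D _).
have yst := cocycle1P y s t; rewrite xE dualB dual_act_act yst.
rewrite -[X in _ = _ - X + _]/((act (loc_gal D s) (y t) : dual_module A) a + y s a).
by rewrite opprD addrA subrK.
Qed.

(** The Leibniz rule again; the sign comes from the degree of [x]. *)
Lemma loc_cup_coboundaryr (chi : dual_module A) x (y : Gv -> dual_module A) :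
  (forall s, y s = act (loc_gal D s) chi - chi) ->
  forall s t, loc_cup x y s t =
    @d1 _ (Gm_module (Fvs_in D)) (fun s => loc_gm D
      (- (act (loc_gal D s) chi : dual_module A) (x s))) s t.
Proof.
move=> yE s t; rewrite /d1 loc_gm_act -loc_gmB -loc_gmD; congr (loc_gm D _).
have xst := cocycle1P x s t.
rewrite -{1}sub0r gm_actB -dual_act_act yE xst dualD actB ghomM actM.
set P := act _ (act _ _); set Q := act _ chi.
rewrite -[LHS]/(P (x s) - Q (x s)).
rewrite -[act s (x t)]/(act (loc_gal D s) (x t)).
rewrite (_ : gm_act _ 0 = 0) ?sub0r; last exact: (@act0 _ (Gm_module j)).
by rewrite opprK addKr.
Qed.

(** [loc_pairing] is defined through the representatives chosen by [rep1]; this permits the use of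
    any others. They are replaced one factor at a time. *)
Lemma cls2_loc_cup x y :
  cls2 (loc_cup (rep1 (cls1 x)) (rep1 (cls1 y))) = cls2 (loc_cup x y).
Proof.
have /cls1P[a xa] := rep1K (cls1 x); have /cls1P[chi ychi] := rep1K (cls1 y).
set x' := rep1 _ in xa *; set y' := rep1 _ in ychi *.
transitivity (cls2 (loc_cup x y')).
  apply: (cls2_eq (loc_cup_cocycle x' y') (loc_cup_cocycle x y')).
    apply: (loc_gm_continuous (x := fun s => y' s a)).
    apply: (continuous_op2 (g := fun=> a) (dual_eval_continuous lcA)
      (@Z1_continuous _ _ y')).
    exact: continuous_cst.
  move=> s t; rewrite -(loc_cup_coboundaryl y' xa).
  by rewrite /loc_cup dualB loc_gmB.
apply: (cls2_eq (loc_cup_cocycle x y') (loc_cup_cocycle x y)).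
  apply: (loc_gm_continuous
    (x := fun s => - (act (loc_gal D s) chi : dual_module A) (x s))).
  apply: (@continuous_opp (Gm Fs)); apply: (dual_act_eval_continuous lcA acA).
  - exact: ghom_continuous.
  - exact: (@Z1_continuous _ _ x).
  - exact: continuous_cst.
move=> s t; rewrite -(loc_cup_coboundaryr x ychi).
by rewrite /loc_cup actB -loc_gmB.
Qed.

Lemma loc_cupBr x y y' : cls2 (loc_cup x (y - y')) =
  cls2 (loc_cup x y) - cls2 (loc_cup x y').
Proof.
rewrite -(cls2B (loc_cup_cocycle x y) (loc_cup_cocycle x y')).
congr cls2; apply: funext => s; apply: funext => t.
by rewrite /loc_cup -loc_gmB; congr (loc_gm D _); rewrite actB.
Qed.

End Cup.
End LocalCup.

(** * The local quadratic map of a theta group *)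

Section QuadraticMap.
Variables (R : realType) (F Fs : fieldType) (j : {rmorphism F -> Fs}).
Variable L : forall v : place R F, local_datum j v.
Variables (A : gmodule (gal j)) (H : theta_group A) (v : place R F).
Notation Gv := (gal (Fvs_in (L v))).
Notation r := (loc_gal (L v)).

(** [u] is continuous because the image of [th_in] is discrete, and it satisfies the cocycle
    condition by associativity in [H]. *)
Lemma theta_lift_cocycle (b : Gv -> H) (u : Gv -> Gv -> Gm Fs) :
  continuous b ->
  (forall s t, (b s * th_act (r s) (b t))%g =
               (th_in H (u s t) * b (s * t)%g)%g) ->
  (fun s t => loc_gm (L v) (u s t)) \in @cocycle2 Gv (Gm_module (Fvs_in (L v))).
Proof.
move=> bc bu; apply: Gv_cocycle2.
  apply: (@th_in_continuousI _ _ _ _ H).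
  rewrite (_ : (fun _ => _) = fun p : Gv * Gv =>
    (b p.1 * th_act (r p.1) (b p.2) * (b (p.1 * p.2)%g)^-1)%g); last first.
    by apply: funext => p; rewrite bu mulgK.
  apply: th_mulc.
    apply: th_mulc; first exact: continuous_compose bc (@continuous_fst _ _).
    apply: th_actc; last exact: continuous_compose bc (@continuous_snd _ _).
    exact: continuous_compose (@ghom_continuous _ _ r) (@continuous_fst _ _).
  exact/th_invc/(continuous_compose bc)/gal_mul_continuous.
move=> s t w; have /th_in_inj E :
    th_in H (gm_act (r s) (u t w) + u s (t * w)%g) =
    th_in H (u s t + u (s * t)%g w).
  apply: (@mulIg _ (b (s * t * w)%g)).
  rewrite !th_inM -[RHS]mulgA -bu [RHS]mulgA -bu -[RHS]mulgA ghomM th_actM.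
  rewrite -th_act_morph bu th_act_morph -th_in_act [RHS]mulgA -(th_central _ (b s)).
  by rewrite -[RHS]mulgA bu [RHS]mulgA (mulgA s).
by rewrite [X in X - _]addrAC E addrK subrr.
Qed.

(** Two lifts of the same cochain differ by a continuous central cochain [z], so [u] and [u'] differ
    by its coboundary. *)
Lemma theta_lift_cohomologous (b b' : Gv -> H) (u u' : Gv -> Gv -> Gm Fs) :
  continuous b -> continuous b' ->
  (forall s, th_pi (b s) = th_pi (b' s)) ->
  (forall s t, (b s * th_act (r s) (b t))%g =
               (th_in H (u s t) * b (s * t)%g)%g) ->
  (forall s t, (b' s * th_act (r s) (b' t))%g =
               (th_in H (u' s t) * b' (s * t)%g)%g) ->
  cls2 (fun s t => loc_gm (L v) (u s t) : Gm_module (Fvs_in (L v))) =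
  cls2 (fun s t => loc_gm (L v) (u' s t) : Gm_module (Fvs_in (L v))).
Proof.
move=> bc b'c bb' bu b'u.
have [z zE] := choice (fun s => th_pi_eq (bb' s)).
have zc : continuous z.
  apply: (@th_in_continuousI _ _ _ _ H).
  rewrite (_ : (fun _ => _) = fun s => (b s * (b' s)^-1)%g); last first.
    by apply: funext => s; rewrite zE mulgK.
  exact/th_mulc/th_invc.
apply: (cls2_eq (theta_lift_cocycle bc bu) (theta_lift_cocycle b'c b'u)).
  exact: (loc_gm_continuous zc).
move=> s t; rewrite /d1 loc_gm_act -!loc_gmB -loc_gmD; congr (loc_gm _ _).
have := bu s t; rewrite (zE s) (zE t) (zE (s * t)%g) th_act_morph -th_in_act.
rewrite -mulgA (mulgA (b' s)) -th_central !mulgA -th_inM -mulgA b'u !mulgA.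
rewrite -!th_inM => /mulIg/th_in_inj E.
have -> : u s t = z s + gm_act (r s) (z t) + u' s t - z (s * t)%g.
  by rewrite E addrK.
by rewrite addrAC addrK -addrA addrC.
Qed.

Lemma q_value_unique (c : H1 (loc_module (L v) A)) e e' :
  q_value H c e -> q_value H c e' -> e = e'.
Proof.
move=> [a [b [u [-> bc ba bu ->]]]] [a' [b' [u' [/cls1P[m aa'] b'c b'a' b'u ->]]]].
have [n nm] := th_pi_surj H m.
(* Twisted conjugation by a lift [n] of [m] carries [b] to a lift of [a'] with the same defect [u],
   which leaves two lifts of one cocycle to compare. *)
pose b0 s := (n * b s * (th_act (r s) n)^-1)%g.
apply: (@theta_lift_cohomologous b0 b') => // [|s|s t|s t].
- apply: th_mulc; first by apply: th_mulc => //; exact: continuous_cst.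
  apply: th_invc; apply: th_actc; last exact: continuous_cst.
  exact: ghom_continuous.
- rewrite !th_piM th_piV th_pi_act nm ba b'a' -[a s](subrK (a' s)) aa'.
  rewrite -[act s m]/(act (r s) m).
  by rewrite addrAC addrA addrA subrK subrr add0r.
- have {}bu : (b s * th_act (r s) (b t))%g = (th_in H (u s t) * b (s * t)%g)%g.
    by rewrite bu mulgVK.
  rewrite /b0 !th_act_morph th_actV -th_actM -ghomM.
  rewrite -!mulgA [in LHS](mulgA (th_act _ n)^-1%g) mulVg mul1g.
  rewrite [in LHS](mulgA (b s)) bu -!mulgA.
  by rewrite mulgA -th_central !mulgA.
- by rewrite b'u mulgVK.
Qed.

Lemma q_locE (a : Z1 (loc_module (L v) A)) (b : Gv -> H)
    (u : Gv -> Gv -> Gm Fs) :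
  continuous b -> (forall s, th_pi (b s) = a s) ->
  (forall s t, (b s * th_act (r s) (b t))%g =
               (th_in H (u s t) * b (s * t)%g)%g) ->
  q_loc H (cls1 a) = cls2 (fun s t => loc_gm (L v) (u s t)).
Proof.
move=> bc ba bu; pose e0 : H2 (Gm_module (Fvs_in (L v))) :=
  cls2 (fun s t => loc_gm (L v) (u s t)).
have qe0 : q_value H (cls1 a) e0.
  by exists a, b, u; split => // s t; rewrite bu mulgK.
rewrite /q_loc; case: xgetP => [e _ qe|/(_ e0)//].
exact: q_value_unique qe qe0.
Qed.

End QuadraticMap.

(** * Orthogonality and adjunction *)

Section Orthogonality.
Variables (R : realType) (F Fs : fieldType) (j : {rmorphism F -> Fs}).
Variable L : forall v : place R F, local_datum j v.
Variable inv : forall v : place R F, H2 (Gm_module (Fvs_in (L v))) -> QmodZ.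
Hypothesis invD : forall v c c', @inv v (c + c') = @inv v c + @inv v c'.

Lemma invB v c c' : @inv v (c - c') = @inv v c - @inv v c'.
Proof. by apply/eqP; rewrite eq_sym subr_eq -invD subrK. Qed.

Lemma place_sumE (A : set (place R F)) (x : place R F -> QmodZ) :
  (forall v, x v != 0 -> A v) ->
  place_sum x = \sum_(v \in A) x v.
Proof.
move=> xA; apply/esym/fsbig_widen => // v [_ nA].
by apply: contra_notP nA => /eqP; exact: xA.
Qed.

Lemma place_sumB (x y : place R F -> QmodZ) :
  finite_set [set v | x v != 0] -> finite_set [set v | y v != 0] ->
  place_sum (fun v => x v - y v) = place_sum x - place_sum y.
Proof.
move=> xf yf; pose A := [set v | x v != 0] `|` [set v | y v != 0].
have Af : finite_set A by rewrite finite_setU.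
rewrite !(@place_sumE A) ?fsbig_finite ?sumrB // => v /=; [by right|by left|].
have [->|] := eqVneq (x v) 0; last by left.
by have [->|] := eqVneq (y v) 0; [rewrite subrr eqxx | right].
Qed.

Section Pairing.
Variable A : gmodule (gal j).
Hypothesis lcA : locally_compact_space A.
Hypothesis acA : continuous_action A.

Lemma loc_pairingE (x : rprod L A) (y : rprod L (dual_module A)) v a c :
  x v = cls1 a -> y v = cls1 c ->
  loc_pairing inv x y v = inv (cls2 (loc_cup a c)).
Proof. by move=> xa yc; rewrite /loc_pairing xa yc cls2_loc_cup. Qed.

Lemma orthogonal_pairB (x : rprod L A) (y y' : rprod L (dual_module A)) :
  orthogonal_pair inv x y -> orthogonal_pair inv x y' ->
  orthogonal_pair inv x (y - y').
Proof.
move=> [xyf xy0] [xy'f xy'0].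
have E : loc_pairing inv x (y - y') =
    fun v => loc_pairing inv x y v - loc_pairing inv x y' v.
  apply: funext => v.
  rewrite -invB -(loc_cupBr lcA acA); apply: loc_pairingE; first by rewrite rep1K.
  by rewrite cls1B !rep1K.
split; last by rewrite E place_sumB // xy0 xy'0 subrr.
have Af : finite_set ([set v | loc_pairing inv x y v != 0] `|`
  [set v | loc_pairing inv x y' v != 0]) by rewrite finite_setU.
apply: sub_finite_set Af => v /=; rewrite E.
have [->|] := eqVneq (loc_pairing inv x y v) 0; last by left.
have [->|] := eqVneq (loc_pairing inv x y' v) 0; last by right.
by rewrite subrr eqxx.
Qed.

End Pairing.

Section Adjoint.
Variables (M1 M M2 : gmodule (gal j)) (iota : gmor M1 M) (proj : gmor M M2).
Variables (fH : gmor M (dual_module M)) (f2 : gmor M2 (dual_module M1)).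
Hypotheses (lcM1 : locally_compact_space M1) (acM1 : continuous_action M1).
Hypotheses (lcM : locally_compact_space M) (acM : continuous_action M).
Hypothesis f2P : forall m m1, f2 (proj m) m1 = fH m (iota m1).

(** With the images of [rep1 (x v)] and [rep1 (w v)] as representatives, [f2P] makes the two cup
    products equal as cochains. *)
Lemma loc_pairing_adjoint (x : rprod L M1) (w : rprod L M) v :
  loc_pairing inv x (rprod_map f2 (rprod_map proj w)) v =
  loc_pairing inv (rprod_map iota x) (rprod_map fH w) v.
Proof.
rewrite (loc_pairingE lcM1 acM1 (a := rep1 (x v))
  (c := Z1map (loc_map L f2 v) (Z1map (loc_map L proj v) (rep1 (w v))))).
- rewrite (loc_pairingE lcM acM (a := Z1map (loc_map L iota v) (rep1 (x v)))
    (c := Z1map (loc_map L fH v) (rep1 (w v)))) //.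
  congr (inv (cls2 _)); apply: funext => s; apply: funext => t.
  rewrite /loc_cup /=; congr (loc_gm _ (gm_act _ _)).
  by rewrite f2P gmor_act.
- by rewrite rep1K.
- by rewrite /= -H1map_cls1.
Qed.

(** This puts the second argument of the Cassels-Tate pairing in the Selmer group. Locally the
    correction is [f2 (proj w)] with [w] in [W], and adjunction reduces its orthogonality to [W1] to
    condition (3). *)
Lemma Sel_sub_adjoint (W1 : set (rprod L M1)) (W : set (rprod L M))
    (psi : Z1 (dual_module M1)) (phi : H1 M2) (w : rprod L M) :
  rprod_map iota @` W1 `<=` orth_dual inv (rprod_map fH @` W) ->
  Sel (orth inv W1) (cls1 psi) -> W w ->
  (forall v, rprod_map proj w v = H1res (loc_gal (L v)) phi) ->
  Sel (orth inv W1) (cls1 psi - H1map f2 phi).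
Proof.
move=> W1W [y yW1 yE] Ww wphi.
exists (y - rprod_map f2 (rprod_map proj w)) => [x W1x|v].
  apply: (orthogonal_pairB lcM1 acM1); first exact: yW1.
  have [] : orthogonal_pair inv (rprod_map iota x) (rprod_map fH w).
    by apply: W1W; [exists x | exists w].
  by rewrite /orthogonal_pair (funext (loc_pairing_adjoint x w)).
rewrite -[LHS]/(y v - H1map (loc_map L f2 v) (rprod_map proj w v)).
rewrite yE wphi -(rep1K phi) H1map_cls1 -cls1B !H1res_cls1 H1map_cls1 -cls1B.
by congr cls1; exact: val_inj.
Qed.

End Adjoint.

End Orthogonality.

(** * The cochain computation *)

Section MainComputation.
Variables (R : realType) (F Fs : fieldType) (j : {rmorphism F -> Fs}).
Variable L : forall v : place R F, local_datum j v.
Variable inv : forall v : place R F, H2 (Gm_module (Fvs_in (L v))) -> QmodZ.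
Variables (M1 M M2 : gmodule (gal j)) (iota : gmor M1 M) (proj : gmor M M2).
Variables (W : set (rprod L M)) (H : theta_group M).
Variables (fH : gmor M (dual_module M)) (f2 : gmor M2 (dual_module M1)).
Variables (s : M1 -> H) (psiPS : Z1 (dual_module M1)).
Hypotheses (iotaI : injective iota)
  (exactM : forall m, proj m = 0 <-> exists m1, m = iota m1)
  (projS : forall m2, exists m, proj m = m2).
Hypotheses (lcM1 : locally_compact_space M1) (acM1 : continuous_action M1).
Hypotheses (acM : continuous_action M).
Hypothesis iota_emb : forall (T : topologicalType) (h : T -> M1),
  continuous (fun t => iota (h t)) -> continuous h.
Hypothesis proj_lift : forall (T : topologicalType) (h : T -> M2),
  continuous h -> exists2 f : T -> M, continuous f & forall t, proj (f t) = h t.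
Hypotheses (fHP : theta_map H fH)
  (f2P : forall m m1, f2 (proj m) m1 = fH m (iota m1))
  (sP : theta_section iota s) (psiP : PS_cocycle s psiPS).
Notation r v := (loc_gal (L v)).

(** Compose [f] with a continuous section of [th_pi] to get [B]. As [phi] is a cocycle, [d1 f] is
    killed by [proj], so the defect of [B] lies above [iota M1]. Its coordinates are continuous by
    [iota_emb] and by discreteness of the central subgroup. *)
Lemma theta_d1 (f : gal j -> M) (phi : Z1 M2) :
  continuous f -> (forall t, proj (f t) = phi t) ->
  exists (B : gal j -> H) (g : gal j -> gal j -> M1)
         (e : gal j -> gal j -> Gm Fs),
    [/\ continuous B, continuous (fun p : gal j * gal j => g p.1 p.2),
        continuous (fun p : gal j * gal j => e p.1 p.2) &
    [/\ forall t, th_pi (B t) = f t, forall t u, iota (g t u) = d1 f t u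
      & forall t u, (B t * th_act t (B u))%g =
                    (theta_elt s (g t u) (e t u) * B (t * u)%g)%g]].
Proof.
move=> fc fphi; have [r0 r0c r0P] := th_pi_section H.
pose B t := r0 (f t); have Bc : continuous B by exact: continuous_compose.
have mulc := @gal_mul_continuous _ _ j.
have d1ker t u : exists m1, d1 f t u = iota m1.
  apply/exactM; rewrite /d1 gmorD gmorB gmor_act !fphi.
  by rewrite cocycle1P opprD addrA addrN sub0r addNr.
have [g gE] := choice (fun p : gal j * gal j => d1ker p.1 p.2).
have Bpi t u : th_pi (B t * th_act t (B u))%g =
    th_pi (s (g (t, u)) * B (t * u)%g)%g.
  have [_ _ spi] := sP; rewrite !th_piM th_pi_act spi -gE !r0P /d1 /=.
  by rewrite addrAC subrK addrC.
have [e eE] := choice (fun p : gal j * gal j => th_pi_eq (Bpi p.1 p.2)).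
have d1c : continuous (fun p : gal j * gal j => d1 f p.1 p.2).
  apply: continuous_add; last exact: continuous_compose fc (@continuous_fst _ _).
  apply: continuous_sub; last exact: (continuous_compose fc mulc).
  apply: (continuous_op2 acM); first exact: continuous_fst.
  exact: continuous_compose fc (@continuous_snd _ _).
have gc : continuous g.
  by apply: iota_emb; rewrite (_ : (fun _ => _) = fun p => d1 f p.1 p.2) //;
    apply: funext => p; rewrite gE.
exists B, (fun t u => g (t, u)), (fun t u => e (t, u)); split => //.
- by rewrite (_ : (fun p => g (p.1, p.2)) = g) //; apply: funext => -[].
- rewrite (_ : (fun p => e (p.1, p.2)) = e); last by apply: funext => -[].
  apply: (@th_in_continuousI _ _ _ _ H).
  have [sc _ _] := sP.
  rewrite (_ : (fun _ => _) = fun p => (B p.1 * th_act p.1 (B p.2) *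
      (s (g p) * B (p.1 * p.2)%g)^-1)%g); last first.
    by apply: funext => -[t u]; rewrite (eE (t, u)) mulgK.
  apply: th_mulc.
    apply: th_mulc; first exact: continuous_compose Bc (@continuous_fst _ _).
    apply: th_actc; first exact: continuous_fst.
    exact: continuous_compose Bc (@continuous_snd _ _).
  apply/th_invc/th_mulc; first exact: continuous_compose.
  exact: (continuous_compose Bc mulc).
- split=> [t|t u|t u]; [exact: r0P|by rewrite -gE|].
  by rewrite (eE (t, u)) /theta_elt mulgA th_central.
Qed.

(** Any representative of [c] lifts the localized [phi] up to the coboundary of some [m2];
    subtracting the coboundary of a lift [m] of [m2] makes the lifting exact without changing the
    class. *)
Lemma Z1_lift_local (v : place R F) (phi : Z1 M2)
    (c : H1 (loc_module (L v) M)) :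
  H1map (loc_map L proj v) c = H1res (r v) (cls1 phi) ->
  exists z : Z1 (loc_module (L v) M), cls1 z = c /\
    forall t, proj (z t) = phi (r v t).
Proof.
rewrite H1res_cls1 -{1}(rep1K c) H1map_cls1 => /cls1P[m2 zE].
have [m mE] := projS m2.
pose w t := @act _ (loc_module (L v) M) t m - m.
have wz : w \in @cocycle1 _ (loc_module (L v) M).
  apply/asboolP; split=> [|t u].
    apply: continuous_sub; last exact: continuous_cst.
    apply: (continuous_op2 acM); last exact: continuous_cst.
    exact: ghom_continuous.
  by rewrite /d1 /w actB actM opprB [X in X + _]addrC !subrKA subrr.
exists (rep1 c - MkZ1 wz); split.
  rewrite -[RHS]rep1K; apply/cls1P; exists (- m) => t.
  rewrite -[LHS]/((rep1 c t - w t) - rep1 c t).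
  by rewrite addrAC subrr sub0r /w opprB actN opprK addrC.
move=> t; rewrite -[_ t]/(rep1 c t - w t) gmorB gmorB gmor_act mE.
rewrite -[RHS](subKr (proj (rep1 c t))); congr (_ - _).
exact: esym (zE t).
Qed.

(** The pairing has the same value for all choices, so one convenient choice suffices. For this one,
    the two sums agree term by term. *)
Lemma CTP_choice_q_locsum (phi : H1 M2) (phiM : rprod L M) :
  W phiM -> (forall v, rprod_map proj phiM v = H1res (r v) phi) ->
  exists C : CTP_choice iota proj W phi (cls1 psiPS - H1map f2 phi),
    CTP_value inv C = q_locsum inv H phiM.
Proof.
move=> WphiM phiMP; pose z2 := rep1 phi.
have [f fc fz2] := proj_lift (@Z1_continuous _ _ z2).
have [B [g [e [Bc gc ec [Bf gE BE]]]]] := theta_d1 fc fz2.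
have [psi [psi_cls psiE]] : exists psi : Z1 (dual_module M1),
    cls1 psi = cls1 psiPS - H1map f2 phi /\
    forall t m, psi t m = psiPS t m - f2 (z2 t) m.
  by exists (psiPS - Z1map f2 z2); rewrite cls1B.
have mulc := @gal_mul_continuous _ _ j.
have dg t u v : d2 g t u v = 0.
  apply: iotaI; rewrite gmor0.
  have /cocycle2P[_ d20] := d1_cocycle2 mulc acM fc.
  by rewrite -[RHS](d20 t u v) /d2 gmorB gmorD gmorB gmor_act !gE.
have de t u v : e t u + e (t * u)%g v =
    gm_act t (e u v) + psi t (act t (g u v)) + e t (u * v)%g.
  rewrite (theta_cochain_d2 iotaI fHP f2P sP psiP BE) Bf fz2 psiE.
  by rewrite addrA.
pose eps t u : Gm_module j := psi (t * u)%g (g t u) - e t u.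
have epsc : continuous2 eps.
  apply: continuous_sub; last exact: ec.
  have psic : continuous (fun p : gal j * gal j => psi (p.1 * p.2)%g).
    exact: (continuous_compose (@Z1_continuous _ _ psi) mulc).
  exact: (continuous_op2 (dual_eval_continuous lcM1) psic gc).
have {}phiMP v : H1map (loc_map L proj v) (phiM v) = H1res (r v) (cls1 z2).
  by rewrite rep1K; exact: phiMP.
have zP v := cid (Z1_lift_local (phiMP v)).
pose z v : Z1 (loc_module (L v) M) := sval (zP v).
have z_cls v : cls1 (z v) = phiM v := (svalP (zP v)).1.
have zE v t : proj (z v t) = z2 (r v t) := (svalP (zP v)).2 t.
have hP v t : exists m1, f (r v t) - z v t = iota m1.
  by apply/exactM; rewrite gmorB zE fz2 subrr.
pose h v := projT1 (choice (hP v)); have hE v t : iota (h v t) = f (r v t) - z v t.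
  by rewrite (projT2 (choice (hP v)) t).
pose C := @CTPChoice _ _ _ _ L _ _ _ iota proj W phi (cls1 psiPS - H1map f2 phi)
  z2 (rep1K phi) psi psi_cls f fc fz2 g gE eps epsc (cup_one_d2 dg de) z zE
  (ex_intro2 _ _ phiM WphiM (fun v => esym (z_cls v))) h hE.
exists C; rewrite /CTP_value /q_locsum; congr place_sum; apply: funext => v.
congr (inv _); rewrite -z_cls.
have rc := @ghom_continuous _ _ (r v).
have hc : continuous (h v).
  apply: iota_emb; rewrite (_ : (fun _ => _) = fun t => f (r v t) - z v t).
    apply: continuous_sub; first exact: continuous_compose.
    exact: (@Z1_continuous _ _ (z v)).
  by apply: funext => t; rewrite hE.
have [sc sD spi] := sP.
pose b t := ((s (h v t))^-1 * B (r v t))%g.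
have bc : continuous b.
  by apply: th_mulc; [apply: th_invc; exact: continuous_compose
                     |exact: continuous_compose].
have bz t : th_pi (b t) = z v t.
  by rewrite /b th_piM th_piV spi Bf hE opprB subrK.
have bpi t u : th_pi (b t * th_act (r v t) (b u))%g = th_pi (b (t * u)%g).
  by rewrite th_piM th_pi_act !bz cocycle1P addrC.
(* Since [b] lifts a cocycle, its defect is central; it computes [q_loc]. *)
have [u' u'E] := choice (fun p => th_pi_eq (bpi p.1 p.2)).
pose u t w := u' (t, w).
have uE t w : (b t * th_act (r v t) (b w))%g =
    (th_in H (u t w) * b (t * w)%g)%g := u'E (t, w).
rewrite (q_locE bc bz uE).
have BrE t w : (B (r v t) * th_act (r v t) (B (r v w)))%g =
  (theta_elt s (g (r v t) (r v w)) (e (r v t) (r v w)) * B (r v (t * w)%g))%g.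
  by rewrite ghomM BE.
have bB t : B (r v t) = (s (h v t) * b t)%g by rewrite mulVKg.
have loc t w := theta_cochain_local iotaI fHP f2P sP psiP BrE uE bB t w.
have eloc t w : e (r v t) (r v w) =
    psi (r v t) (act (r v t) (h v w)) + u t w.
  by rewrite (loc t w).2 bz zE psiE.
have E := cup_one_local (r := r v) (fun t w => (loc t w).1) eloc.
pose k t : Gm_module (Fvs_in (L v)) := loc_gm (L v) (psi (r v t) (h v t)).
have kc : continuous k.
  apply: (@loc_gm_continuous _ _ _ _ _ (L v)).
  apply: (continuous_op2 (dual_eval_continuous lcM1) _ hc).
  exact: (continuous_compose (@Z1_continuous _ _ psi) rc).
(* Subtracting the coboundary of [k] keeps the class and makes the two cochains equal pointwise. *)
rewrite -(cls2_sub_d1 (@gal_mul_continuous _ _ _) (@gm_act_continuous2 _ _ _)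
  (theta_lift_cocycle bc uE) kc).
congr cls2; apply: funext => t; apply: funext => w.
rewrite /d1 loc_gm_act -!loc_gmB -loc_gmD -loc_gmB; congr (loc_gm _ _).
by rewrite -E /= /eps ghomM.
Qed.

End MainComputation.

(** * Modules over the l-adic integers *)

Section Zl_arithmetic.
Variable l : nat.
Hypothesis l_prime : prime l.
Implicit Types (c d : Zl l).

Lemma Zl_gt1 n : (1 < l ^ n.+1)%N.
Proof. by rewrite -{1}(expn0 l) ltn_exp2l ?prime_gt1. Qed.

Lemma Zl_modulus n : (Zp_trunc (l ^ n.+1)).+2 = (l ^ n.+1)%N.
Proof. by rewrite Zp_cast ?Zl_gt1. Qed.

Lemma modn_Zl n m : (m %% (Zp_trunc (l ^ n.+1)).+2 = m %% l ^ n.+1)%N.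
Proof. by rewrite Zl_modulus. Qed.

Lemma Zl_natr m n : (m%:R : Zl l) n = m%:R.
Proof. by elim: m => [//|m IH]; rewrite !mulrS -[LHS]/(1 + (m%:R : Zl l) n) IH. Qed.

Lemma Zl_expr k n : ((l%:R ^+ k : Zl l) n) = (l ^ k)%:R.
Proof. by rewrite -natrX Zl_natr. Qed.

Lemma val_reduceZ n (a : 'Z_(l ^ n.+2)) : reduceZ a = (a %% l ^ n.+1)%N :> nat.
Proof. exact: modn_Zl. Qed.

Lemma Zl_digit_lt c n : (c n < l ^ n.+1)%N.
Proof. by rewrite -{2}Zl_modulus ltn_ord. Qed.

Lemma Zl_digit_mod c n m : ((c (m + n)%N : nat) %% l ^ n.+1)%N = c n.
Proof.
elim: m => [|m IH]; first by rewrite modn_small // Zl_digit_lt.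
rewrite -IH -[in RHS](Zl_coherent c) val_reduceZ modn_dvdm //.
by rewrite dvdn_exp2l // ltnS leq_addl.
Qed.

Lemma Zl_digit_expr0 k n : (n < k)%N -> ((l ^ k)%:R : 'Z_(l ^ n.+1)) = 0.
Proof.
move=> nk; apply: ord_inj => /=; rewrite val_Zp_nat ?Zl_gt1 //.
by apply/eqP; apply: dvdn_exp2l.
Qed.

Lemma Zl_divl k c : (forall n, (n < k)%N -> c n = 0) ->
  exists d, c = l%:R ^+ k * d.
Proof.
move=> c0; have lk_gt0 : (0 < l ^ k)%N by rewrite expn_gt0 prime_gt0.
(* Division by [l ^ k] loses [k] powers of precision, so digit [n] of the quotient is read off from
   digit [n + k]. *)
pose w n : 'Z_(l ^ n.+1) := inZp (c (n + k)%N %/ l ^ k).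
have w_val n : w n = (c (n + k)%N %/ l ^ k)%N :> nat.
  rewrite /= modn_Zl modn_small // ltn_divLR // -expnD addSn addnC.
  exact: Zl_digit_lt.
have w_coh n : reduceZ (w n.+1) = w n.
  apply: ord_inj; rewrite [LHS]val_reduceZ !w_val modn_divl -expnD addSn.
  by rewrite (Zl_digit_mod c (n + k) 1) -w_val.
have dvd n : (l ^ k %| c (n + k)%N)%N.
  case: k c0 {lk_gt0 w w_val w_coh} => [|k] c0; first by rewrite expn0 dvd1n.
  by rewrite /dvdn addnS -addSn Zl_digit_mod c0.
exists (MkZl w_coh); apply: Zl_eq => n.
rewrite -[RHS]/((l%:R ^+ k : Zl l) n * w n) Zl_expr; apply: ord_inj.
rewrite -[w n]natr_Zp -natrM val_Zp_nat ?Zl_gt1 //.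
by rewrite w_val mulnC divnK // (addnC n k) Zl_digit_mod.
Qed.

(** Digit [k] of [c], as a natural number, serves as [i]: it agrees with [c] modulo [l ^ k.+1]. *)
Lemma Zl_nat_add k c : exists i d, (i < l ^ k.+1)%N /\
  c = i%:R + l%:R ^+ k.+1 * d.
Proof.
have [|d dE] := @Zl_divl k.+1 (c - (c k : nat)%:R).
  move=> n; rewrite ltnS => /subnK nk.
  rewrite -[LHS]/(c n - ((c k : nat)%:R : Zl l) n) Zl_natr.
  apply/eqP; rewrite subr_eq0; apply/eqP; apply: ord_inj.
  by rewrite val_Zp_nat ?Zl_gt1 // -nk Zl_digit_mod.
by exists (c k), d; split; [exact: Zl_digit_lt | rewrite -dE addrC subrK].
Qed.

(** Every digit reduces to [c 0] modulo [l], hence is invertible, and the inverses are again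
    coherent. *)
Lemma Zl_unit c : c 0 != 0 -> exists d, d * c = 1.
Proof.
move=> c0.
have cU n : c n \is a GRing.unit.
  rewrite -[c n]natr_Zp unitZpE ?Zl_gt1 // coprimeXl // prime_coprime //.
  apply: contra c0 => lc; apply/eqP/ord_inj; rewrite /= -(Zl_digit_mod c 0 n).
  by rewrite addn0 expn1; exact/eqP.
have w_coh n : reduceZ (c n.+1)^-1 = (c n)^-1.
  apply: (mulIr (cU n)); rewrite mulVr ?cU // -[X in _ * X](Zl_coherent c n).
  have reduceM (a b : 'Z_(l ^ n.+2)) : reduceZ a * reduceZ b = reduceZ (a * b).
    apply: ord_inj; rewrite val_reduceZ /= !modn_Zl modnMm.
    by rewrite modn_dvdm // dvdn_exp2l.
  by rewrite reduceM mulVr ?cU //; apply: ord_inj.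
exists (MkZl w_coh); apply: Zl_eq => n.
by rewrite -[LHS]/((c n)^-1 * c n) mulVr ?cU.
Qed.

(** An element of least valuation divides all the others. Here [n] is the first index at which some
    element has a nonzero digit, and [d] is such an element. *)
Lemma Zl_principal (I : set (Zl l)) :
  I 0 ->
  exists2 d, I d & forall c, I c -> exists q, c = q * d.
Proof.
move=> I0; pose P n := `[< exists c, I c /\ c n != 0 >].
have [exP|I_0] := pselect (exists n, P n); last first.
  exists 0 => // c Ic; exists 0; rewrite mulr0; apply: Zl_eq => n.
  by apply: contra_notP I_0 => /eqP cn; exists n; apply/asboolP; exists c.
case: (ex_minnP exP) => n /asboolP[d [Id dn]] min_n.
have small c m : I c -> (m < n)%N -> c m = 0.
  move=> Ic; rewrite ltnNge; apply: contraNeq => cm; apply: min_n.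
  by apply/asboolP; exists c.
exists d => // c Ic.
have [c' cE] := @Zl_divl n c (fun m => small c m Ic).
have [d' dE] := @Zl_divl n d (fun m => small d m Id).
(* If [d'] were not a unit, [d] would be divisible by [l ^ n.+1] and its digit [n] would vanish. *)
have [|w wd'] := @Zl_unit d'.
  apply: contra dn => /eqP d'0; have [m|d'' d''E] := @Zl_divl 1 d'.
    by case: m.
  apply/eqP; rewrite dE d''E mulrA -exprSr.
  rewrite -[LHS]/((l%:R ^+ n.+1 : Zl l) n * d'' n) Zl_expr.
  by rewrite Zl_digit_expr0 // mul0r.
by exists (c' * w); rewrite cE dE mulrCA -(mulrA c') wd' mulr1.
Qed.

End Zl_arithmetic.

Section Zl_modules.
Variables (l : nat) (F Fs : fieldType) (j : {rmorphism F -> Fs}).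
Hypothesis l_prime : prime l.

Lemma Zl_expr_cvg0 : (fun k => l%:R ^+ k : Zl l) @ \oo --> (0 : Zl l).
Proof.
move=> O [_ [[B Bop <-] B0 BO]].
pose K n := discrete_topology 'Z_(l ^ n.+1).
have Fc : (fun k => digits (l%:R ^+ k : Zl l) : prod_topology K) @ \oo -->
    (digits (0 : Zl l) : prod_topology K).
  apply: prod_cvg => n A /nbhs_singleton A0.
  exists n.+1 => // k /= nk; rewrite /= Zl_expr // Zl_digit_expr0 //; exact: A0.
have : nbhs (digits (0 : Zl l) : prod_topology K) B by exact: open_nbhs_nbhs.
move=> /Fc FB; have FF : Filter (\oo : set_system nat) by exact: eventually_filter.
exact: (@filterS _ \oo FF _ _ (fun k => BO (l%:R ^+ k : Zl l)) FB).
Qed.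

Section Module.
Variables (A : gmodule (gal j)) (scal : Zl l -> A -> A).
Hypothesis AZl : Zl_action scal.
Local Notation pw k := (l%:R ^+ k : Zl l).
Implicit Types (a b : A) (P U : set A) (t : seq A).

Lemma scal_l0 c : scal c 0 = 0.
Proof. by apply: (addrI (scal c 0)); rewrite -(scalDr AZl) !addr0. Qed.

Lemma scal_r0 a : scal 0 a = 0.
Proof. by apply: (addrI (scal 0 a)); rewrite -(scalDl AZl) !addr0. Qed.

Lemma scalNr c a : scal c (- a) = - scal c a.
Proof. by apply: (addrI (scal c a)); rewrite -(scalDr AZl) !subrr scal_l0. Qed.

Lemma scalBr c a b : scal c (a - b) = scal c a - scal c b.
Proof. by rewrite (scalDr AZl) scalNr. Qed.

Lemma scalNl c a : scal (- c) a = - scal c a.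
Proof. by apply: (addrI (scal c a)); rewrite -(scalDl AZl) !subrr scal_r0. Qed.

Lemma scal_continuousr c : continuous (scal c).
Proof.
apply: (continuous_op2 (scal_continuous AZl) (f := fun=> c) (g := id)).
  exact: continuous_cst.
by move=> ?; exact: cvg_id.
Qed.

(** Powers of [l] tend to 0 and scalar multiplication is jointly continuous; compactness makes the
    exponent uniform. *)
Lemma compact_scal_small U (O : set A) : compact U -> nbhs (0 : A) O ->
  exists k, forall u, U u -> O (scal (pw k) u).
Proof.
move=> /compact_near_coveringP Uc O0.
have [|k _ kP] := Uc nat \oo (fun k u => O (scal (pw k) u)) _.
  move=> u Uu; have [[X Y] /= [X0 Yu] XY] :
      nbhs ((0, u) : Zl l * A) [set p : Zl l * A | O (scal p.1 p.2)].
    by apply: (scal_continuous AZl); rewrite /= scal_r0.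
  exists (Y, [set k | X (pw k)]); first by split => //; exact: Zl_expr_cvg0 X0.
  by move=> [u' k] [/= Yu' Xk]; exact: (XY (_, _)).
by exists k => u Uu; exact: (kP k (leqnn k) u Uu).
Qed.

Lemma scal_small a (O : set A) : nbhs (0 : A) O -> exists k, O (scal (pw k) a).
Proof.
by move=> /(compact_scal_small (@compact_set1 _ a))[k kP]; exists k; exact: kP.
Qed.

Record is_submodule P : Prop := {
  submod0 : P 0;
  submodD : forall a b, P a -> P b -> P (a + b);
  submodZ : forall c a, P a -> P (scal c a) }.

Lemma submodN P a : is_submodule P -> P a -> P (- a).
Proof.
move=> Pm Pa; rewrite (_ : - a = scal (- 1) a); first exact: submodZ.
by rewrite scalNl (scal1 AZl).
Qed.

Lemma submodB P a b : is_submodule P -> P a -> P b -> P (a - b).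
Proof. by move=> Pm Pa Pb; apply: submodD => //; exact: submodN. Qed.

(** The recursive form lets inductions remove one generator at a time. *)
Fixpoint span t : set A :=
  if t is x :: t' then [set a | exists c, span t' (a - scal c x)] else [set 0].

Lemma span_submodule t : is_submodule (span t).
Proof.
elim: t => [|x t IH] /=.
  by split=> [//|_ _ -> ->|c _ ->] /=; rewrite ?addr0 ?scal_l0.
split=> [|a b [c ac] [d bd]|c a [d ad]].
- by exists 0; rewrite /= scal_r0 subr0; exact: submod0.
- by exists (c + d); rewrite /= (scalDl AZl) opprD addrACA; exact: submodD.
- by exists (c * d); rewrite /= (scalA AZl) -scalBr; exact: submodZ.
Qed.

Lemma span_sum n (e : 'I_n -> A) (c : 'I_n -> Zl l) (s : seq 'I_n) :
  span [seq e k | k <- s] (\sum_(k <- s) scal (c k) (e k)).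
Proof.
elim: s => [|k s IH] /=; first by rewrite big_nil.
by exists (c k); rewrite big_cons addrC addKr.
Qed.

Lemma fg_span U : fg_submodule scal U ->
  exists t, (forall x, x \in t -> U x) /\ U `<=` span t.
Proof.
move=> [n [e [Ue eU]]]; exists [seq e k | k <- enum 'I_n]; split.
  by move=> x /mapP[k _ ->].
by move=> a /eU[c ->]; rewrite -big_enum; exact: span_sum.
Qed.

Lemma span_noetherian t P : is_submodule P ->
  exists t', (forall x, x \in t' -> P x) /\ P `&` span t `<=` span t'.
Proof.
move=> Pm; elim: t => [|x t [t' [Pt' tt']]]; first by exists [::]; split=> // a [].
(* The coefficients of [x] occurring in [P] are all multiples of one coefficient [d], realized by
   [a]. Subtracting a multiple of [a] brings an element of [P] into [span t]. *)
have [|d [a [Pa ad]] dP] := Zl_principal l_prime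
    (I := [set c | exists a, P a /\ span t (a - scal c x)]).
  exists 0; rewrite scal_r0 subr0; split; first exact: submod0.
  exact: submod0 (span_submodule _).
exists (a :: t'); split=> [y|b [Pb /= [c bc]]].
  by rewrite inE => /predU1P[->//|]; exact: Pt'.
have [|q cE] := dP c; first by exists b.
exists q; apply: tt'; split; first by apply: submodB => //; exact: submodZ.
rewrite (_ : b - _ = (b - scal c x) - scal q (a - scal d x)).
  have tm := span_submodule t.
  by apply: submodB => //; exact: submodZ.
by rewrite scalBr cE (scalA AZl) opprB addrA subrK.
Qed.

Lemma span_cosets t P : is_submodule P ->
  (forall x, x \in t -> exists k, P (scal (pw k) x)) ->
  exists s : seq A, forall a, span t a -> exists2 b, b \in s & P (a - b).
Proof.
move=> Pm; elim: t => [|x t IH] tP.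
  exists [:: 0] => _ ->; exists 0; rewrite ?inE ?eqxx // subrr; exact: submod0.
have [k Pk] := tP x (mem_head _ _).
have [y ty|s sP] := IH; first by apply: tP; rewrite inE ty orbT.
(* [P] contains [l ^ k x], hence [l ^ k.+1 x], so the coefficient of [x] matters only modulo
   [l ^ k.+1]. *)
exists [seq scal i%:R x + b | i <- iota 0 (l ^ k.+1), b <- s].
move=> a /= [c /sP[b sb Pb]].
have [i [d [ik cE]]] := Zl_nat_add l_prime k c.
exists (scal i%:R x + b); first by apply: allpairs_f => //; rewrite mem_iota.
rewrite (_ : a - _ = a - scal c x - b + scal (d * l%:R) (scal (pw k) x)).
  by apply: submodD => //; exact: submodZ.
rewrite -(scalA AZl) cE (scalDl AZl) exprS mulrC mulrA.
by rewrite !opprD !addrA [RHS]addrAC subrK.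
Qed.

(** Finitely many cosets of [P] cover [span t]. Those other than [P] are closed and miss 0, so a
    neighbourhood of 0 avoids them all. *)
Lemma torsion_nbhs t P : is_submodule P -> closed P ->
  (forall x, x \in t -> exists k, P (scal (pw k) x)) ->
  nbhs (0 : A) [set a | span t a -> P a].
Proof.
move=> Pm Pc /(span_cosets Pm)[s sP].
have sO : nbhs (0 : A) [set a | forall b, b \in s -> P (a - b) -> P b].
  elim: s {sP} => [|b s IH]; first by apply: nearW => a b.
  have [Pb|nPb] := pselect (P b).
    by apply: filterS IH => a aP b'; rewrite inE => /predU1P[->//|]; exact: aP.
  have Ob : nbhs (0 : A) [set a | ~ P (a - b)].
    have bc : continuous (fun a : A => a - b).
      by apply: continuous_sub; [move=> ?; exact: cvg_id|exact: continuous_cst].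
    apply: (bc 0 (~` P)); apply: open_nbhs_nbhs; split; first exact: closed_openC.
    by rewrite /= sub0r => /(submodN Pm); rewrite opprK.
  apply: filterS2 Ob IH => a nPa aP b'; rewrite inE => /predU1P[->//|]; exact: aP.
apply: filterS sO => a aP /sP[b sb Pab]; rewrite -(subrK b a).
by apply: submodD => //; exact: aP sb Pab.
Qed.

Lemma scal_image_submodule c U : is_submodule U -> is_submodule (scal c @` U).
Proof.
move=> Um; split=> [|_ _ [a Ua <-] [b Ub <-]|d _ [a Ua <-]].
- by exists 0; [exact: submod0 | rewrite scal_l0].
- by exists (a + b); [exact: submodD | rewrite (scalDr AZl)].
- by exists (scal d a); [exact: submodZ | rewrite -!(scalA AZl) mulrC].
Qed.

Lemma scal_image_compact c U : compact U -> compact (scal c @` U).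
Proof.
move=> Uc; apply: continuous_compact Uc; apply: continuous_subspaceT.
exact: scal_continuousr.
Qed.

Lemma submodule_locally_compact U : compact U -> nbhs (0 : A) U ->
  locally_compact_space A.
Proof.
move=> Uc U0 a; exists (+%R a @` U).
  apply: continuous_compact Uc; apply: continuous_subspaceT.
  by apply: continuous_add; [exact: continuous_cst|move=> ?; exact: cvg_id].
have := nbhs_unshift a U0; apply: filterS => b Ub.
by exists (b - a) => //; rewrite addrC subrK.
Qed.

End Module.

Lemma image_submodule (A B : gmodule (gal j)) (scalA : Zl l -> A -> A)
    (scalB : Zl l -> B -> B) (f : gmor A B) (U : set A) :
  (forall c a, f (scalA c a) = scalB c (f a)) ->
  is_submodule scalA U -> is_submodule scalB (f @` U).
Proof.
move=> fZ Um; split=> [|_ _ [a Ua <-] [b Ub <-]|d _ [a Ua <-]].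
- by exists 0; [exact: submod0 Um | exact: gmor0].
- by exists (a + b); [exact: submodD Um _ _ Ua Ub | exact: gmorD].
- by exists (scalA d a); [exact: submodZ Um _ _ Ua | exact: fZ].
Qed.

Lemma gmor_image_compact (A B : gmodule (gal j)) (f : gmor A B) (U : set A) :
  compact U -> compact (f @` U).
Proof.
move=> Uc; apply: continuous_compact Uc; apply: continuous_subspaceT.
exact: gmor_continuous.
Qed.

Section Morphisms.
Variables (A B : gmodule (gal j)) (scalA : Zl l -> A -> A).
Variables (scalB : Zl l -> B -> B) (f : gmor A B) (U : set A) (t : seq B).
Hypotheses (AZl : Zl_action scalA) (BZl : Zl_action scalB).
Hypothesis fZ : forall c a, f (scalA c a) = scalB c (f a).
Hypotheses (Um : is_submodule scalA U) (Uc : compact U) (U0 : nbhs (0 : A) U).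
Hypotheses (hB : hausdorff_space B) (t0 : nbhs (0 : B) (span scalB t)).

(** The image of [l ^ k U] is compact, hence closed, and some power of [l] carries each generator
    [f a] into it because [l ^ m a] tends to 0. *)
Let fU_nbhs t' k : (forall x, x \in t' -> exists a, x = f a) ->
  nbhs (0 : B) [set b | span scalB t' b -> (f @` (scalA (l%:R ^+ k) @` U)) b].
Proof.
move=> t'f; apply: torsion_nbhs => //.
- by apply: (image_submodule fZ); exact: scal_image_submodule.
- apply: compact_closed hB _; apply: gmor_image_compact.
  exact: scal_image_compact.
- move=> x /t'f[a ->]; have [m Um'] := scal_small AZl a U0.
  exists (k + m)%N; exists (scalA (l%:R ^+ (k + m)) a); last exact: fZ.
  by exists (scalA (l%:R ^+ m) a); rewrite // -(Defs.scalA AZl) -exprD.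
Qed.

Lemma Zl_open_mapping k : (forall b, exists a, f a = b) ->
  nbhs (0 : B) (f @` (scalA (l%:R ^+ k) @` U)).
Proof.
move=> fS; have /(_ t k) := fU_nbhs; have tf x : x \in t -> exists a, x = f a.
  by have [a <-] := fS x; exists a.
by move=> /(_ tf); apply: filterS2 t0 => b tb; exact.
Qed.

(** The image of [f] meets [span t] inside the span of finitely many [t'] in the image. A small
    difference [f (h y) - f (h x)] therefore lies in [f (l ^ k U)], and injectivity puts [h y - h x]
    in [l ^ k U]. *)
Lemma Zl_embedding (T : topologicalType) (h : T -> A) : injective f ->
  continuous (fun x => f (h x)) -> continuous h.
Proof.
move=> fI fhc x N Nx; have O0 := nbhs_shift Nx.
have [k kO] := compact_scal_small AZl Uc O0.
have rm : is_submodule scalB [set b | exists a, b = f a].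
  split=> [|_ _ [a ->] [b ->]|c _ [a ->]]; first by exists 0; rewrite gmor0.
    by exists (a + b); rewrite gmorD.
  by exists (scalA c a).
have [t' [t'f tt']] := span_noetherian BZl t rm.
have := fU_nbhs k t'f => fN.
have dc : continuous (fun y => f (h y) - f (h x)).
  by apply: continuous_sub => //; exact: continuous_cst.
have Ox : nbhs (f (h x) - f (h x)) [set b | span scalB t b /\
    (span scalB t' b -> (f @` (scalA (l%:R ^+ k) @` U)) b)].
  by rewrite subrr; exact: filterI.
apply: (filterS _ (dc x _ Ox : nbhs x [set y | _])) => y /= [ty t'y].
have [|_ [a Ua <-] fa] := t'y.
  by apply: tt'; split => //; exists (h y - h x); rewrite gmorB.
have /fI aE : f (scalA (l%:R ^+ k) a) = f (h y - h x) by rewrite gmorB.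
by have := kO a Ua; rewrite aE /= addrC subrK.
Qed.

End Morphisms.
End Zl_modules.

(** * Continuous sections *)

Section ContinuousSection.
Variables (G : groupType) (A B : gmodule G) (p : gmor A B) (U : nat -> set A).
Hypothesis pS : forall b, exists a, p a = b.
Hypotheses (U_0 : forall k, U k 0)
  (U_B : forall k a b, U k a -> U k b -> U k (a - b))
  (U_decr : forall k, U k.+1 `<=` U k)
  (U_compact : compact (U 0)) (U_closed : forall k, closed (U k))
  (U_small : forall O, nbhs (0 : A) O -> exists k, U k `<=` O)
  (pU_nbhs : forall k, nbhs (0 : B) (p @` U k))
  (hB : hausdorff_space B).

Let p0 : p 0 = 0.
Proof. by rewrite -(subrr (0 : A)) gmorB subrr. Qed.

Let pD a b : p (a + b) = p a + p b.
Proof. by rewrite -{1}[b]opprK gmorB -(sub0r b) gmorB p0 sub0r opprK. Qed.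

Let VB k a b : (p @` U k) a -> (p @` U k) b -> (p @` U k) (a - b).
Proof.
move=> [x Ux <-] [y Uy <-]; exists (x - y); last exact: gmorB.
exact: (U_B Ux Uy).
Qed.

Let V_decr k b : (p @` U k.+1) b -> (p @` U k) b.
Proof. by move=> [x Ux <-]; exists x => //; exact: U_decr. Qed.

(* Choosing from a set which only depends on the class of [b] modulo [p (U k)]
   makes [approx k] locally constant, hence the limit continuous. *)
Fixpoint approx (k : nat) (b : B) : A :=
  if k is k'.+1 then
    xget 0 [set a | U k' (a - approx k' b) /\ (p @` U k) (b - p a)]
  else xget 0 [set a | (p @` U 0) (b - p a)].

Lemma approx_lift k b : (p @` U k) (b - p (approx k b)).
Proof.
elim: k => [|k [u Uu uE]] /=.
  case: xgetP => [a _ //|]; have [a <-] := pS b => /(_ a) /=; rewrite subrr.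
  by case; exists 0.
(* The default of [xget] is excluded by correcting the previous approximation by [u], which accounts
   for the whole error. *)
case: xgetP => [a _ []//|/(_ (approx k b + u))]; case; split.
  by rewrite addrC addKr.
by exists 0 => //; rewrite p0 pD uE [p _ + _]addrC subrK subrr.
Qed.

Lemma approx_succ k b : U k (approx k.+1 b - approx k b).
Proof.
rewrite [approx k.+1 b]/=; case: xgetP => [a _ []//|].
have [u Uu uE] := approx_lift k b.
move=> /(_ (approx k b + u)); case; split; first by rewrite addrC addKr.
by exists 0 => //; rewrite p0 pD uE [p _ + _]addrC subrK subrr.
Qed.

Lemma approx_locally_constant k b c :
  (p @` U k) (b - c) -> approx k b = approx k c.
Proof.
elim: k b c => [|k IH] b c Vbc.
  have VE d e : (p @` U 0) (d - e) -> (p @` U 0) d -> (p @` U 0) e.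
    by move=> Vde Vd; rewrite -(subKr d e); exact: VB.
  rewrite /=; congr xget; apply/seteqP; split=> a /=; apply: VE.
    by rewrite opprB subrKA.
  by rewrite opprB subrKA -opprB -sub0r; apply: VB => //; exists 0.
rewrite /= (IH b c); last exact: V_decr.
have VE d e : (p @` U k.+1) (d - e) -> (p @` U k.+1) d -> (p @` U k.+1) e.
  by move=> Vde Vd; rewrite -(subKr d e); exact: VB.
congr xget; apply/seteqP; split=> a /= [Ua] Va; split=> //; apply: VE Va.
  by rewrite opprB subrKA.
by rewrite opprB subrKA -opprB -sub0r; apply: VB => //; exists 0.
Qed.

Let UD k a b : U k a -> U k b -> U k (a + b).
Proof.
by move=> Ua Ub; rewrite -[b]opprK -[- b]sub0r; do 2! apply: U_B => //.
Qed.

Let U_mono m k : U (m + k) `<=` U k.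
Proof. by elim: m => [//|m IH] a /U_decr; exact: IH. Qed.

Lemma approx_cauchy k m b : U k (approx (m + k) b - approx k b).
Proof.
elim: m => [|m IH]; first by rewrite subrr.
rewrite (_ : _ - _ = (approx (m + k).+1 b - approx (m + k) b) +
  (approx (m + k) b - approx k b)); last by rewrite addrA subrK.
by apply: UD => //; apply/U_mono/approx_succ.
Qed.

(** All approximations lie in the compact translate of [U 0] by [approx 0 b]. A cluster point lies
    in each closed translate of [U k] by [approx k b], which contains a tail. *)
Lemma approx_limit b : exists a, forall k, U k (a - approx k b).
Proof.
have tr x : continuous (fun a : A => a - x).
  by apply: continuous_sub; [move=> ?; exact: cvg_id|exact: continuous_cst].
have Kc : compact [set a | U 0 (a - approx 0 b)].
  rewrite (_ : [set a | _] = (fun a => a + approx 0 b) @` U 0).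
    apply: continuous_compact U_compact; apply: continuous_subspaceT.
    by apply: continuous_add; [move=> ?; exact: cvg_id|exact: continuous_cst].
  apply/seteqP; split=> [a Ua|_ [a Ua <-]] /=; last by rewrite addrK.
  by exists (a - approx 0 b) => //; rewrite subrK.
pose Fb : set_system A := (approx ^~ b) @ \oo.
have FK k : Fb [set a | U k (a - approx k b)].
  by exists k => // m /= /subnK <-; exact: approx_cauchy.
have [a [_ aF]] := Kc Fb (fmap_proper_filter _ _) (FK 0).
exists a => k.
have := (continuous_closedP _).1 (tr (approx k b)) _ (@U_closed k).
by apply => N Na; exact: aF (FK k) Na.
Qed.

Lemma continuous_section :
  exists2 q : B -> A, continuous q & forall b, p (q b) = b.
Proof.
have [q qP] := choice approx_limit.
exists q => [b N Nq|b].
  (* Near [b] the value of [approx k] is constant and [q] stays within [U k] of it, so [q] varies by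
     at most [U k]. *)
  have [k kO] := U_small (nbhs_shift Nq).
  apply: filterS (nbhs_unshift b (pU_nbhs k)) => c /= Vcb.
  have cE := approx_locally_constant Vcb.
  have := kO (q c - q b); rewrite /= [q b + _]addrC subrK; apply.
  rewrite (_ : q c - q b = (q c - approx k c) - (q b - approx k b)).
    exact: U_B.
  by rewrite cE opprB addrA subrK.
(* The error [b - p (q b)] lies in every [p (U k)], hence in every neighbourhood of 0, and [B] is
   Hausdorff. *)
apply/esym/subr0_eq/esym/hB => S N S0 Nw; exists (b - p (q b)).
split; last exact: nbhs_singleton.
have pc := @gmor_continuous _ _ _ p.
have [k kS] : exists k, U k `<=` p @^-1` S.
  by apply: U_small; apply: pc; rewrite p0.
have [u Uu uE] := approx_lift k b.
by have /= := kS _ (U_B Uu (qP b k)); rewrite !gmorB uE opprB subrKA.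
Qed.

End ContinuousSection.

(** * The theorem *)

Lemma discrete_locally_compact (T : topologicalType) :
  (forall a : T, open [set a]) -> locally_compact_space T.
Proof.
move=> To a; exists [set a]; first exact: compact_set1.
exact: open_nbhs_nbhs.
Qed.

Lemma discrete_source_continuous (S T : topologicalType) (f : S -> T) :
  (forall a : S, open [set a]) -> continuous f.
Proof.
move=> So a N Na; apply: (@filterS _ (nbhs a) _ [set a]).
  by move=> _ ->; exact: nbhs_singleton Na.
exact: open_nbhs_nbhs.
Qed.

Lemma discrete_injective_continuous (T A B : topologicalType) (f : A -> B)
    (h : T -> A) :
  (forall b : B, open [set b]) -> injective f ->
  continuous (fun t => f (h t)) -> continuous h.
Proof.
move=> Bo fI fhc t N Nt.
have fN : nbhs (f (h t)) [set f (h t)] by exact: open_nbhs_nbhs.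
apply: (filterS _ (fhc t _ fN : nbhs t [set u | _])) => u /fI /= ->.
exact: nbhs_singleton Nt.
Qed.

(** * Topology of exact sequences in the two categories *)

Section ExactTopology.
Variables (R : realType) (F Fs : fieldType) (j : {rmorphism F -> Fs}).
Variable L : forall v : place R F, local_datum j v.
Variables (M1 M M2 : gmodule (gal j)) (iota : gmor M1 M) (proj : gmor M M2).
Variables (W1 : set (rprod L M1)) (W : set (rprod L M)) (W2 : set (rprod L M2)).

Lemma acceptable_submodule (A : gmodule (gal j)) (l : nat)
    (scal : Zl l -> A -> A) :
  acceptable L scal -> exists (U : set A) (t : seq A),
    [/\ is_submodule scal U, compact U, nbhs (0 : A) U & U `<=` span scal t].
Proof.
move=> [AZl _ _ [U [Uo Uc [U0 UD UZ _] /fg_span[t [_ Ut]] _]] _].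
by exists U, t; split => //; exact: open_nbhs_nbhs.
Qed.

Lemma SMod_inf_splitting (l : nat) (scal1 : Zl l -> M1 -> M1)
    (scal : Zl l -> M -> M) (scal2 : Zl l -> M2 -> M2) : prime l ->
  acceptable L scal1 -> acceptable L scal -> acceptable L scal2 ->
  (forall c m, iota (scal1 c m) = scal c (iota m)) ->
  (forall c m, proj (scal c m) = scal2 c (proj m)) ->
  injective iota -> (forall m2, exists m, proj m = m2) ->
  (forall (T : topologicalType) (h : T -> M1),
     continuous (fun t => iota (h t)) -> continuous h) /\
  exists2 q : M2 -> M, continuous q & forall m2, proj (q m2) = m2.
Proof.
move=> lp acc1 acc acc2 iZ pZ iI pS.
have [U1 [t1 [U1m U1c U10 U1t]]] := acceptable_submodule acc1.
have [U [t [Um Uc U0 Ut]]] := acceptable_submodule acc.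
have [U2 [t2 [U2m U2c U20 U2t]]] := acceptable_submodule acc2.
have [[Z1 h1 _ _ _] [Z h _ _ _] [Z2 h2 _ _ _]] := And3 acc1 acc acc2.
split=> [T g|].
  apply: (Zl_embedding lp Z1 Z iZ U1m U1c U10 h _ iI).
  exact: filterS Ut U0.
(* The submodules [l ^ k U] form the filtration for successive approximation; the open mapping
   property makes their images neighbourhoods of 0. *)
pose V k := scal (l%:R ^+ k) @` U.
have Vm k : is_submodule scal (V k) by exact: scal_image_submodule.
have Vc k : compact (V k) by exact: scal_image_compact.
apply: (@continuous_section _ _ _ proj V) => //.
- by move=> k; exact: submod0 (Vm k).
- by move=> k a b; exact: (submodB Z (Vm k)).
- move=> k _ [a Ua <-]; exists (scal l%:R a); first exact: (submodZ Um).
  by rewrite -(scalA Z) -exprSr.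
- by move=> k; exact: compact_closed.
- move=> O /(compact_scal_small lp Z Uc)[k kO]; exists k => _ [a Ua <-].
  exact: kO.
- move=> k; apply: (Zl_open_mapping lp Z Z2 pZ Um Uc U0 h2 _ k pS).
  exact: filterS U2t U20.
Qed.

Lemma exact_topology :
  (exact_SMod iota proj W1 W W2 \/
   exists l : nat,
     [/\ prime l, l \notin [pchar F] & exact_SMod_inf iota proj W1 W W2 l]) ->
  [/\ exact_with_conditions iota proj W1 W W2,
      locally_compact_space M1 /\ continuous_action M1,
      locally_compact_space M /\ continuous_action M,
      forall (T : topologicalType) (h : T -> M1),
        continuous (fun t => iota (h t)) -> continuous h
    & exists2 q : M2 -> M, continuous q & forall m2, proj (q m2) = m2].
Proof.
move=> [[[ac1 o1 _ _] [ac o _ _] [_ o2 _ _] ex]|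
  [l [lp _ [scal1 [scal [scal2 [[acc1 _] [acc _] [acc2 _] [iZ pZ] ex]]]]]]].
  have [iI _ pS _ _] := ex; split => //.
  - by split => //; exact: discrete_locally_compact.
  - by split => //; exact: discrete_locally_compact.
  - by move=> T h; exact: discrete_injective_continuous.
  - have [q qP] := choice pS; exists q => //.
    exact: discrete_source_continuous.
have [iI _ pS _ _] := ex.
have [emb sec] := SMod_inf_splitting lp acc1 acc acc2 iZ pZ iI pS.
have [_ _ ac1 _ _] := acc1; have [_ _ ac _ _] := acc.
split => //; split => //.
  by have [U1 [_ [_ U1c U10 _]]] := acceptable_submodule acc1;
    exact: submodule_locally_compact U1c U10.
by have [U [_ [_ Uc U0 _]]] := acceptable_submodule acc;
  exact: submodule_locally_compact Uc U0.
Qed.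

End ExactTopology.

Theorem theorem5p10
  (R : realType) (F Fs : fieldType) (j : {rmorphism F -> Fs})
  (L : forall v : place R F, local_datum j v)
  (inv : forall v : place R F, H2 (Gm_module (Fvs_in (L v))) -> QmodZ)
  (M1 M M2 : gmodule (gal j)) (iota : gmor M1 M) (proj : gmor M M2)
  (W1 : set (rprod L M1)) (W : set (rprod L M)) (W2 : set (rprod L M2))
  (H : theta_group M) (fH : gmor M (dual_module M))
  (f2 : gmor M2 (dual_module M1))
  (s : M1 -> H) (psiPS : Z1 (dual_module M1))
  (ctp : H1 M2 -> H1 (dual_module M1) -> QmodZ)
  (phi : H1 M2) (phiM : rprod L M) :
  global_field F ->
  separable_closure j ->
  (forall v, invariant_map (inv v)) ->
  (exact_SMod iota proj W1 W W2 \/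
   exists l : nat,
     [/\ prime l, l \notin [pchar F] & exact_SMod_inf iota proj W1 W W2 l]) ->
  is_CTP inv iota proj W1 W W2 ctp ->
  theta_map H fH ->
  (* (1) *)
  (forall g h : H, (exists m, th_pi g = iota m) ->
     (exists m, th_pi h = iota m) -> (g * h = h * g)%g) ->
  (* (2) *)
  (forall x, W1 x -> q_locsum inv H (rprod_map iota x) = 0) ->
  (* (3) *)
  rprod_map iota @` W1 `<=` orth_dual inv (rprod_map fH @` W) ->
  (forall m m1, f2 (proj m) m1 = fH m (iota m1)) ->
  theta_section iota s ->
  PS_cocycle s psiPS ->
  Sel (orth inv W1) (cls1 psiPS) ->
  Sel W2 phi ->
  W phiM ->
  (forall v, rprod_map proj phiM v = H1res (loc_gal (L v)) phi) ->
  ctp phi (cls1 psiPS - H1map f2 phi) = q_locsum inv H phiM.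

Proof.
move=> _ _ invP exactE ctpP fHP _ _ W1W f2P sP psiP psi_Sel phi_Sel WphiM phiMP.
have [[iI ex pS _ _] [lc1 ac1] [lc ac] emb [q qc qP]] := exact_topology exactE.
have lift (T : topologicalType) (h : T -> M2) : continuous h ->
    exists2 f : T -> M, continuous f & forall t, proj (f t) = h t.
  by move=> hc; exists (fun t => q (h t)) => //; exact: continuous_compose.
have [C CE] := CTP_choice_q_locsum inv iI ex pS lc1 ac emb lift fHP f2P sP
  psiP WphiM phiMP.
(* It remains to see that the second argument is a Selmer class. *)
rewrite -CE; apply: ctpP => //.
have invD v c c' : inv v (c + c') = inv v c + inv v c' by case: (invP v).
exact: (Sel_sub_adjoint invD lc1 ac1 lc ac f2P W1W psi_Sel WphiM phiMP).
Qed.
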